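(* Let $\Omega\subset\mathbb{R}^{2}$ be a domain, $\vec F\in C^{1}(\Omega)$ a planar vector field, and $u:\Omega\to\mathbb{R}$ a $C^{1}$ smooth function such that $\Omega$ is a nonsingular domain, i.e. $\nabla u+\vec F\neq 0$ at every point of $\Omega$. Then for any point $p\in\Omega$ there is $r_{1}>0$ such that $B_{r_{1}}(p)\subset\Omega$ and there exists a unique characteristic curve passing through $p$ in $B_{r_{1}}(p)$.
   Context: $N\equiv\dfrac{\nabla u+\vec F}{|\nabla u+\vec F|}$, and $N^{\perp}$ is the rotation of $N$ by $-\pi/2$, i.e. if locally $N=(\cos\theta,\sin\theta)$ then $N^{\perp}=(\sin\theta,-\cos\theta)$. Characteristic curves are the integral curves of the $C^{0}$ vector field $N^{\perp}$. $B_{r}(p)$ is the open disc of radius $r$ centred at $p$. Uniqueness in $B_{r_1}(p)$ means that any two such integral curves through $p$ coincide inside $B_{r_{1}}(p)$. *)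

(* Defs.v *)
From Stdlib Require Import Reals Lra.
From Coquelicot Require Import Coquelicot.
Open Scope R_scope.

Definition connected_set (D : R * R -> Prop) : Prop :=
  forall U V : R * R -> Prop, open U -> open V ->
    (forall x, D x -> U x \/ V x) ->
    (forall x, D x -> ~ (U x /\ V x)) ->
    (forall x, D x -> U x) \/ (forall x, D x -> V x).

Definition planar_domain (D : R * R -> Prop) : Prop :=
  open D /\ (exists x, D x) /\ connected_set D.

(* [norm] on [R * R] is the Euclidean norm, so this is a round disc, whereas
   [ball] of the product uniform space is a square. *)
Definition open_disc (p : R * R) (r : R) (q : R * R) : Prop :=
  norm (minus q p) < r.

Definition partial1 (f : R * R -> R) (x : R * R) : R :=
  Derive (fun s => f (s, snd x)) (fst x).

Definition partial2 (f : R * R -> R) (x : R * R) : R :=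
  Derive (fun s => f (fst x, s)) (snd x).

Definition grad (f : R * R -> R) (x : R * R) : R * R :=
  (partial1 f x, partial2 f x).

(* Only used on open [D], where continuity of the total functions [partial1 f]
   and [partial2 f] at a point of [D] depends on their values in [D] alone. *)
Definition C1_on (D : R * R -> Prop) (f : R * R -> R) : Prop :=
  forall x, D x ->
    ex_derive (fun s => f (s, snd x)) (fst x) /\
    ex_derive (fun s => f (fst x, s)) (snd x) /\
    continuous (partial1 f) x /\
    continuous (partial2 f) x.

Definition C1_field_on (D : R * R -> Prop) (F : R * R -> R * R) : Prop :=
  C1_on D (fun x => fst (F x)) /\ C1_on D (fun x => snd (F x)).

Definition nonsingular (D : R * R -> Prop) (F : R * R -> R * R)
    (u : R * R -> R) : Prop :=
  forall x, D x -> plus (grad u x) (F x) <> zero.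

Definition unit_N (F : R * R -> R * R) (u : R * R -> R) (x : R * R) : R * R :=
  scal (/ norm (plus (grad u x) (F x))) (plus (grad u x) (F x)).

(* Rotation by -pi/2. *)
Definition perp (v : R * R) : R * R := (snd v, - fst v).

Definition Nperp (F : R * R -> R * R) (u : R * R -> R) (x : R * R) : R * R :=
  perp (unit_N F u x).

(* The curve is [gamma] restricted to the open interval [I] (possibly
   unbounded); values of [gamma] outside [I] are irrelevant. *)
Definition integral_curve (V : R * R -> R * R) (D : R * R -> Prop)
    (I : R -> Prop) (gamma : R -> R * R) : Prop :=
  open I /\
  (forall a b t, I a -> I b -> a <= t <= b -> I t) /\
  (forall t, I t -> D (gamma t) /\ is_derive gamma t (V (gamma t))).

Definition characteristic_curve (F : R * R -> R * R) (u : R * R -> R)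
    (D : R * R -> Prop) (I : R -> Prop) (gamma : R -> R * R) : Prop :=
  integral_curve (Nperp F u) D I gamma.

(* The curve [(I, gamma)] passes through [p] at time 0, and every
   characteristic curve in [D] through [p], at whatever time [s], is up to the
   time shift by [s] a restriction of it.  In particular [(I, gamma)] is
   maximal in [D], any two characteristic curves in [D] through [p] agree
   wherever both are defined, and any two maximal ones have the same trace. *)
Definition unique_characteristic_curve_through (F : R * R -> R * R)
    (u : R * R -> R) (D : R * R -> Prop) (p : R * R)
    (I : R -> Prop) (gamma : R -> R * R) : Prop :=
  characteristic_curve F u D I gamma /\ I 0 /\ gamma 0 = p /\
  forall (J : R -> Prop) (eta : R -> R * R) (s : R),
    characteristic_curve F u D J eta -> J s -> eta s = p ->
    forall t, J t -> I (t - s) /\ eta t = gamma (t - s).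

(* Main.v *)
Require Import Defs.
From Stdlib Require Import Reals Lra Lia.
From Coquelicot Require Import Coquelicot.
Open Scope R_scope.

(** Write G = grad u + F; the characteristic curves are annihilated by the 1-form
    G1 dx + G2 dy = du + F1 dx + F2 dy.  Near p one may assume G2 <> 0, exchanging the
    coordinates otherwise.  The function Th = u + int_{y0}^y F2(x,t) dt is then a coordinate
    transversal to the curves, since Th_y = G2, and along a characteristic curve
    dTh = Q dx with Q = - F1 + int_{y0}^y d_x F2(x,t) dt.  Although the direction field is
    merely continuous, Q is Lipschitz in y, because no second derivative of u enters it.
    Hence the integral equation Th(x, f x) = Th(p) + int_{x0}^x Q(s, f s) ds has a solution
    by contraction, and Gronwall's inequality for Th(x, y) - Th(x, f x) puts every
    characteristic curve through p on the graph of f.  On that graph the motion is a scalar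
    autonomous equation with nonvanishing continuous speed, which is uniquely solvable by
    separation of variables. *)

(** * Fixed points of contractions on continuous functions *)

(** The obstacle is that the slope - G1 / G2 of the curves is only continuous, which by itself would
    allow several integral curves through p. The choice of Th and Q separates the regularities: Th_x
    - Q = G1, so that u enters through Th alone, while formally Q_y = d_x F2 - d_y F1 is the curl of
    F, bounded near p because F is C^1. A Lipschitz bound on Q suffices on both sides. For
    existence, y - Th(x, y) already contracts in y once Th_y has been scaled to lie near 1, and the
    integral of Q adds little on a short interval. For uniqueness, Th separates the points of each
    vertical line, so a gap in y is controlled by the gap in Th. The derivative of f is recovered
    afterwards, by differentiating the integral equation. The horizontal speed is G2 / |G|, so the
    condition G2 <> 0 that makes Th transversal also makes the speed on the graph nonzero; elapsed
    time is then a C^1 coordinate on the graph. *)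

Lemma pow_small (q e : R) : 0 <= q < 1 -> 0 < e -> exists n, q ^ n < e.
Proof.
  intros Hq He.
  destruct (pow_lt_1_zero q) with (y := e) as [N HN]; [rewrite Rabs_pos_eq; lra | lra |].
  exists N. apply Rle_lt_trans with (2 := HN N (le_n N)). apply Rle_abs.
Qed.

Lemma continuous_eps_delta (f : R -> R) (x : R) :
  continuous f x <->
  forall eps, 0 < eps -> exists d, 0 < d /\
    forall y, Rabs (y - x) < d -> Rabs (f y - f x) < eps.
Proof.
  split.
  - intros H eps Heps.
    destruct (proj1 (continuity_pt_locally f x) (proj2 (continuity_pt_filterlim f x) H)
      (mkposreal eps Heps)) as [d Hd].
    exists d. split; [apply cond_pos | exact Hd].
  - intros H. apply continuity_pt_filterlim, continuity_pt_locally. intros eps.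
    destruct (H eps (cond_pos eps)) as [d [Hd Hf]]. exists (mkposreal d Hd). exact Hf.
Qed.

Lemma is_derive_eps_delta (f : R -> R) (x l : R) :
  is_derive f x l <->
  forall eps, 0 < eps -> exists d, 0 < d /\
    forall y, Rabs (y - x) < d -> Rabs (f y - f x - l * (y - x)) <= eps * Rabs (y - x).
Proof.
  split.
  - intros H eps Heps. apply is_derive_Reals in H.
    destruct (H eps Heps) as [d Hd]. exists d. split; [apply cond_pos|]. intros y Hy.
    destruct (Req_dec y x) as [->|Hne].
    + replace (f x - f x - l * (x - x)) with 0 by ring.
      replace (x - x) with 0 by ring. rewrite Rabs_R0. lra.
    + assert (Hh : y - x <> 0) by lra.
      specialize (Hd (y - x) Hh Hy). replace (x + (y - x)) with y in Hd by ring.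
      replace (f y - f x - l * (y - x)) with (((f y - f x) / (y - x) - l) * (y - x))
        by (field; exact Hh).
      rewrite Rabs_mult. apply Rmult_le_compat_r; [apply Rabs_pos | lra].
  - intros H. apply is_derive_Reals. intros eps Heps.
    destruct (H (eps / 2)) as [d [Hd Hf]]; [lra|]. exists (mkposreal d Hd). simpl.
    intros h Hh Hhd. specialize (Hf (x + h)).
    replace (x + h - x) with h in Hf by ring. specialize (Hf Hhd).
    replace ((f (x + h) - f x) / h - l) with ((f (x + h) - f x - l * h) / h) by (field; exact Hh).
    rewrite Rabs_div by exact Hh. pose proof (Rabs_pos_lt h Hh).
    apply Rle_lt_trans with (eps / 2); [|lra].
    apply Rmult_le_reg_r with (Rabs h); [assumption|].
    unfold Rdiv at 1. rewrite Rmult_assoc, Rinv_l by lra. lra.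
Qed.

Section FixedPoint.

Variables (y0 r q : R) (T : (R -> R) -> R -> R).

(** The closed ball about the constant [y0] in the uniform distance, on functions defined on the
    whole line. The distance is never formed as a supremum; uniform bounds [e] stand in for it. *)
Definition admissible (f : R -> R) : Prop :=
  (forall x, continuous f x) /\ (forall x, Rabs (f x - y0) <= r).

Hypothesis hq : 0 <= q < 1.
Hypothesis hr : 0 <= r.
Hypothesis T_admissible : forall f, admissible f -> admissible (T f).
Hypothesis T_contracts : forall f g e, admissible f -> admissible g -> 0 <= e ->
  (forall x, Rabs (f x - g x) <= e) -> forall x, Rabs (T f x - T g x) <= q * e.

Fixpoint iterates (n : nat) : R -> R :=
  match n with O => fun _ => y0 | S m => T (iterates m) end.

Lemma iterates_admissible n : admissible (iterates n).
Proof.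
  induction n as [|n IH]; simpl; [|now apply T_admissible].
  split; intros x; [apply continuous_const|].
  replace (y0 - y0) with 0 by ring. rewrite Rabs_R0. exact hr.
Qed.

(** Both iterates arise by applying [T] n times, to [iterates k] and to the constant [y0], which lie
    in one ball. This bounds the tail directly, without summing a geometric series. *)
Lemma iterates_close n k x : Rabs (iterates (n + k) x - iterates n x) <= 2 * r * q ^ n.
Proof.
  revert x. induction n as [|n IH]; intros x; simpl.
  - pose proof (proj2 (iterates_admissible k) x) as H.
    apply Rle_trans with (1 := H). lra.
  - replace (2 * r * (q * q ^ n)) with (q * (2 * r * q ^ n)) by ring.
    apply T_contracts; try apply iterates_admissible; trivial.
    pose proof (pow_le q n (proj1 hq)). apply Rmult_le_pos; lra.
Qed.

Lemma iterates_tail_small e : 0 < e -> exists n, 2 * r * q ^ n < e.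
Proof.
  intros He. destruct (pow_small q (e / (2 * r + 1))) as [n Hn]; [lra | apply Rdiv_lt_0_compat; lra |].
  exists n. apply Rmult_lt_compat_l with (r := 2 * r + 1) in Hn; [|lra].
  replace ((2 * r + 1) * (e / (2 * r + 1))) with e in Hn by (field; lra).
  pose proof (pow_le q n (proj1 hq)). lra.
Qed.

Definition iterates_limit (x : R) : R := real (Lim_seq (fun n => iterates n x)).

Lemma iterates_limit_close n x :
  Rabs (iterates_limit x - iterates n x) <= 2 * r * q ^ n.
Proof.
  assert (Hl : is_lim_seq (fun n => iterates n x) (iterates_limit x)).
  { apply Lim_seq_correct'. apply ex_lim_seq_cauchy_corr. intros eps.
    destruct (iterates_tail_small (eps / 2)) as [N HN]; [pose proof (cond_pos eps); lra|].
    exists N. intros n' m Hn Hm.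
    pose proof (iterates_close N (n' - N) x) as H1.
    pose proof (iterates_close N (m - N) x) as H2.
    replace (N + (n' - N))%nat with n' in H1 by lia.
    replace (N + (m - N))%nat with m in H2 by lia.
    unfold Rabs in *. repeat destruct Rcase_abs; lra. }
  apply (is_lim_seq_le (fun k => Rabs (iterates (n + k) x - iterates n x))
    (fun _ => 2 * r * q ^ n) (Finite _) (Finite _)).
  - intros k. apply iterates_close.
  - apply (is_lim_seq_abs _ (Finite (iterates_limit x - iterates n x))).
    apply is_lim_seq_minus'; [|apply is_lim_seq_const].
    apply is_lim_seq_ext with (fun k => iterates (k + n) x);
      [intros k; now rewrite Nat.add_comm|].
    now apply (is_lim_seq_incr_n (fun k => iterates k x)).
  - apply is_lim_seq_const.
Qed.

Lemma iterates_limit_admissible : admissible iterates_limit.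
Proof.
  split; intros x.
  - apply continuous_eps_delta. intros eps Heps.
    destruct (iterates_tail_small (eps / 4)) as [n Hn]; [lra|].
    destruct (proj1 (continuous_eps_delta _ _) (proj1 (iterates_admissible n) x) (eps / 4))
      as [d [Hd Hc]]; [lra|].
    exists d. split; [exact Hd|]. intros y Hy. specialize (Hc y Hy).
    pose proof (iterates_limit_close n x) as H1.
    pose proof (iterates_limit_close n y) as H2.
    unfold Rabs in *. repeat destruct Rcase_abs; lra.
  - apply le_epsilon. intros e He.
    destruct (iterates_tail_small e He) as [n Hn].
    pose proof (iterates_limit_close n x) as H1.
    pose proof (proj2 (iterates_admissible n) x) as H2.
    unfold Rabs in *. repeat destruct Rcase_abs; lra.
Qed.

Lemma contraction_fixed_point : exists f, admissible f /\ forall x, T f x = f x.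
Proof.
  exists iterates_limit. split; [apply iterates_limit_admissible|]. intros x.
  apply Rminus_diag_uniq, Rabs_eq_0.
  apply Rle_antisym; [|apply Rabs_pos].
  apply le_epsilon. intros e He.
  destruct (iterates_tail_small (e / 2)) as [n Hn]; [lra|].
  pose proof (iterates_limit_close (S n) x) as H1.
  assert (Hp : 0 <= 2 * r * q ^ n) by
    (pose proof (pow_le q n (proj1 hq)); apply Rmult_le_pos; lra).
  pose proof (T_contracts iterates_limit (iterates n) (2 * r * q ^ n)
    iterates_limit_admissible (iterates_admissible n) Hp (iterates_limit_close n) x) as H2.
  simpl in H1.
  replace (2 * r * (q * q ^ n)) with (q * (2 * r * q ^ n)) in H1 by ring.
  assert (q * (2 * r * q ^ n) <= 1 * (2 * r * q ^ n)) by (apply Rmult_le_compat_r; lra).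
  unfold Rabs in *. repeat destruct Rcase_abs; lra.
Qed.

End FixedPoint.

(** * Implicit derivatives and the Gronwall inequality *)

Lemma Rabs_le_near (a b e : R) : Rabs (a - b) <= e -> Rabs a <= Rabs b + e.
Proof.
  intros H. replace a with (b + (a - b)) by ring.
  apply Rle_trans with (1 := Rabs_triang _ _). lra.
Qed.

(** The differentiation half of the implicit function theorem: [f] is already given and continuous,
    and only its derivative is sought, from that of [Phi s (f s)]. With [Phi] independent of its
    first argument it differentiates an inverse function. *)
Lemma implicit_derivative (Phi : R -> R -> R) (f : R -> R) (x a b z : R) :
  continuous f x -> differentiable_pt_lim Phi x (f x) a b -> b <> 0 ->
  is_derive (fun s => Phi s (f s)) x z -> is_derive f x ((z - a) / b).
Proof.
  intros Hf HPhi Hb Hz. apply is_derive_eps_delta. intros eps Heps.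
  pose proof (Rabs_pos_lt b Hb) as Hb'.
  set (K := 2 * (Rabs (z - a) + Rabs b) / Rabs b).
  assert (HK : 0 < K).
  { apply Rdiv_lt_0_compat; [pose proof (Rabs_pos (z - a)); lra | exact Hb']. }
  (* The first bound on [eta] lets the term in [df] be absorbed on the left, giving |df| <= K |dx|;
     the second turns the remaining error [eta * (2 + K)] into [eps * Rabs b]. *)
  set (eta := Rmin (Rabs b / 2) (eps * Rabs b / (2 + K))).
  assert (Heta : 0 < eta).
  { apply Rmin_pos; [lra|]. apply Rdiv_lt_0_compat; [|lra]. now apply Rmult_lt_0_compat. }
  assert (Heta1 : eta <= Rabs b / 2) by apply Rmin_l.
  assert (Heta2 : eta * (2 + K) <= eps * Rabs b).
  { apply Rle_trans with (eps * Rabs b / (2 + K) * (2 + K)).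
    - apply Rmult_le_compat_r; [lra | apply Rmin_r].
    - right. field. lra. }
  destruct (HPhi (mkposreal eta Heta)) as [d1 H1]. simpl in H1.
  destruct (proj1 (is_derive_eps_delta _ _ _) Hz eta Heta) as [d2 [Hd2 H2]].
  destruct (proj1 (continuous_eps_delta _ _) Hf d1 (cond_pos d1)) as [d3 [Hd3 H3]].
  exists (Rmin d1 (Rmin d2 d3)). split; [repeat apply Rmin_pos; trivial; apply cond_pos|].
  intros y Hy. apply Rmin_Rgt in Hy as [Hy1 Hy]. apply Rmin_Rgt in Hy as [Hy2 Hy3].
  specialize (H1 y (f y) Hy1 (H3 y Hy3)). specialize (H2 y Hy2).
  set (dx := y - x) in *. set (df := f y - f x) in *.
  assert (Hmax : Rmax (Rabs dx) (Rabs df) <= Rabs dx + Rabs df).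
  { pose proof (Rabs_pos dx). pose proof (Rabs_pos df). apply Rmax_lub; lra. }
  apply (Rmult_le_compat_l eta) in Hmax; [|lra].
  assert (H4 : Rabs (b * df - (z - a) * dx) <= eta * (2 * Rabs dx + Rabs df)).
  { replace (b * df - (z - a) * dx) with
      ((Phi y (f y) - Phi x (f x) - z * dx) -
       (Phi y (f y) - Phi x (f x) - (a * dx + b * df))) by ring.
    apply Rle_trans with (1 := Rabs_triang _ _). rewrite Rabs_Ropp. lra. }
  assert (H5 : Rabs df <= K * Rabs dx).
  { assert (Rabs b * Rabs df <= Rabs (z - a) * Rabs dx + eta * (2 * Rabs dx + Rabs df)).
    { rewrite <- !Rabs_mult.
      replace (b * df) with ((b * df - (z - a) * dx) + (z - a) * dx) at 1 by ring.
      apply Rle_trans with (1 := Rabs_triang _ _). lra. }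
    assert (eta * (2 * Rabs dx + Rabs df) <= Rabs b / 2 * (2 * Rabs dx + Rabs df)).
    { apply Rmult_le_compat_r; trivial.
      pose proof (Rabs_pos dx). pose proof (Rabs_pos df). lra. }
    apply Rmult_le_reg_l with (Rabs b); [exact Hb'|].
    replace (Rabs b * (K * Rabs dx)) with (2 * (Rabs (z - a) + Rabs b) * Rabs dx)
      by (unfold K; field; lra). lra. }
  apply Rmult_le_reg_l with (Rabs b); [exact Hb'|].
  rewrite <- Rabs_mult.
  replace (b * (df - (z - a) / b * dx)) with (b * df - (z - a) * dx) by (field; exact Hb).
  apply Rle_trans with (1 := H4).
  apply Rle_trans with (eta * (2 + K) * Rabs dx).
  - rewrite Rmult_assoc. apply Rmult_le_compat_l; lra.
  - replace (Rabs b * (eps * Rabs dx)) with (eps * Rabs b * Rabs dx) by ring.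
    apply Rmult_le_compat_r; [apply Rabs_pos | exact Heta2].
Qed.

Lemma mean_value (f df : R -> R) (a b : R) :
  (forall t, Rmin a b <= t <= Rmax a b -> is_derive f t (df t)) ->
  exists c, Rmin a b <= c <= Rmax a b /\ f b - f a = df c * (b - a).
Proof.
  intros H. apply MVT_gen.
  - intros t Ht. apply H. lra.
  - intros t Ht. apply continuity_pt_filterlim, (ex_derive_continuous f). now exists (df t); apply H.
Qed.

Lemma abs_RInt_le_unordered (f : R -> R) (a b M : R) :
  ex_RInt f a b -> (forall t, Rmin a b <= t <= Rmax a b -> Rabs (f t) <= M) ->
  Rabs (RInt f a b) <= Rabs (b - a) * M.
Proof.
  intros Hf HM. destruct (Rle_dec a b) as [Hab|Hab].
  - rewrite (Rabs_pos_eq (b - a)) by lra. apply abs_RInt_le_const; trivial.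
    intros t Ht. apply HM. rewrite Rmin_left, Rmax_right; lra.
  - rewrite <- (Rabs_Ropp (b - a)), (Rabs_pos_eq (- (b - a))) by lra.
    rewrite <- (Rabs_Ropp (RInt f a b)). change (- RInt f a b) with (opp (RInt f a b)).
    rewrite opp_RInt_swap by exact Hf. replace (- (b - a)) with (a - b) by ring.
    apply abs_RInt_le_const; [lra | now apply ex_RInt_swap |].
    intros t Ht. apply HM. rewrite Rmin_right, Rmax_left; lra.
Qed.

Lemma is_derive_primitive (g : R -> R) (a x : R) :
  (forall t, continuous g t) -> is_derive (fun y => RInt g a y) x (g x).
Proof.
  intros Hg. apply is_derive_RInt with a; [|apply Hg].
  apply filter_forall. intros y. apply (RInt_correct (V := R_CompleteNormedModule)).
  apply (ex_RInt_continuous (V := R_CompleteNormedModule)). intros t _. apply Hg.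
Qed.

(** The energy w^2 e^(kt) is nonnegative, vanishes at [s], and cannot grow when moving away from
    [s]: take k = -2C to the right of [s] and k = 2C to the left. *)
Lemma gronwall_zero (J : R -> Prop) (w dw : R -> R) (C s : R) :
  (forall a b t, J a -> J b -> a <= t <= b -> J t) ->
  (forall t, J t -> is_derive w t (dw t)) ->
  (forall t, J t -> Rabs (dw t) <= C * Rabs (w t)) ->
  J s -> w s = 0 -> forall t, J t -> w t = 0.
Proof.
  intros HJ Hw HC Hs Hws t Ht.
  assert (Hbound : forall c, J c -> Rabs (w c * dw c) <= C * (w c * w c)).
  { intros c Hc. rewrite Rabs_mult.
    apply Rle_trans with (Rabs (w c) * (C * Rabs (w c))).
    - apply Rmult_le_compat_l; [apply Rabs_pos | now apply HC].
    - right. transitivity (C * (Rabs (w c) * Rabs (w c))); [ring|].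
      rewrite <- Rabs_mult, Rabs_pos_eq; [reflexivity | apply Rle_0_sqr]. }
  assert (Hg : forall k c, J c -> is_derive (fun t => w t * w t * exp (k * t)) c
      ((2 * (w c * dw c) + k * (w c * w c)) * exp (k * c))).
  { intros k c Hc. pose proof (Hw c Hc) as Hd.
    auto_derive; [repeat split; now exists (dw c)|].
    replace (Derive (fun x => w x) c) with (dw c) by (symmetry; now apply is_derive_unique).
    ring. }
  assert (Hin : forall c, Rmin s t <= c <= Rmax s t -> J c).
  { intros c Hc. destruct (Rle_dec s t).
    - rewrite Rmin_left, Rmax_right in Hc by lra. exact (HJ s t c Hs Ht Hc).
    - rewrite Rmin_right, Rmax_left in Hc by lra. exact (HJ t s c Ht Hs Hc). }
  set (k := if Rle_dec s t then - (2 * C) else 2 * C).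
  destruct (mean_value (fun t => w t * w t * exp (k * t))
    (fun c => (2 * (w c * dw c) + k * (w c * w c)) * exp (k * c)) s t) as [c [Hc E]].
  { intros c Hc. now apply Hg, Hin. }
  specialize (Hbound c (Hin c Hc)). rewrite Hws in E.
  pose proof (exp_pos (k * c)) as Hec. pose proof (exp_pos (k * t)) as Het.
  assert (Hle : w t * w t * exp (k * t) <= 0).
  { replace (w t * w t * exp (k * t)) with
      (w t * w t * exp (k * t) - 0 * 0 * exp (k * s)) by ring.
    rewrite E. revert Hbound. unfold k. generalize (w c * w c). generalize (w c * dw c).
    intros p q Hpq.
    assert (- (C * q) <= p <= C * q) by (unfold Rabs in Hpq; destruct Rcase_abs; lra).
    destruct (Rle_dec s t) as [Hst|Hst].
    - assert (0 <= - (2 * p + - (2 * C) * q) * (t - s)) by (apply Rmult_le_pos; lra). 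
      pose proof (Rmult_le_pos _ _ H0 (Rlt_le _ _ (exp_pos (- (2 * C) * c)))). lra.
    - assert (0 <= (2 * p + 2 * C * q) * (s - t)) by (apply Rmult_le_pos; lra).
      pose proof (Rmult_le_pos _ _ H0 (Rlt_le _ _ (exp_pos (2 * C * c)))). lra. }
  destruct (Req_dec (w t) 0) as [|Hne]; trivial.
  assert (0 < w t * w t) by now apply Rsqr_pos_lt.
  assert (0 < w t * w t * exp (k * t)) by now apply Rmult_lt_0_compat.
  lra.
Qed.

(** * Autonomous scalar equations and the graph of the solution *)

(** Separation of variables: [T x] is the signed time needed to reach [x] from [x0], and [X] is its
    inverse. Since [v] stays within a fixed factor of [v0] on the whole line, [T] is a bijection of
    the line and the flow exists for all times. *)
Lemma autonomous_flow (v : R -> R) (v0 x0 : R) :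
  v0 <> 0 -> (forall x, continuous v x) -> (forall x, Rabs (v x - v0) <= Rabs v0 / 2) ->
  exists T X : R -> R,
    T x0 = 0 /\ (forall x, is_derive T x (/ v x)) /\
    (forall x, X (T x) = x) /\ (forall t, is_derive X t (v (X t))).
Proof.
  intros Hv0 Hv Hb.
  pose proof (Rabs_pos_lt v0 Hv0) as Hv0'.
  assert (Hvx : forall x, Rabs v0 / 2 <= Rabs (v x) <= 2 * Rabs v0).
  { intros x. specialize (Hb x). unfold Rabs in *. repeat destruct Rcase_abs; lra. }
  assert (Hne : forall x, v x <> 0).
  { intros x E. specialize (Hvx x). rewrite E, Rabs_R0 in Hvx. lra. }
  set (T := fun x => RInt (fun s => / v s) x0 x).
  assert (HT : forall x, is_derive T x (/ v x)).
  { intros x. apply (is_derive_primitive (fun s => / v s)). intros t.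
    apply continuity_pt_filterlim, continuity_pt_inv; [|apply Hne].
    apply continuity_pt_filterlim, Hv. }
  assert (HTc : forall x, continuity_pt T x).
  { intros x. apply continuity_pt_filterlim, (ex_derive_continuous T). now eexists; apply HT. }
  assert (HT0 : T x0 = 0) by exact (RInt_point x0 (fun s => / v s)).
  (* The sign of v0 is arbitrary, but v0 * T is increasing with slope at least 1/2. *)
  assert (Hslope : forall x y, exists c, T y - T x = / v c * (y - x)).
  { intros x y. destruct (mean_value T (fun s => / v s) x y) as [c [_ E]]; [|now exists c].
    intros t _. apply HT. }
  assert (Hratio : forall c, / 2 <= v0 / v c).
  { intros c. specialize (Hb c). specialize (Hne c).
    destruct (Rlt_dec 0 (v c)).
    - apply Rmult_le_reg_r with (v c); [assumption|].
      unfold Rdiv. rewrite Rmult_assoc, Rinv_l by assumption.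
      unfold Rabs in *. repeat destruct Rcase_abs; lra.
    - apply Rmult_le_reg_r with (- v c); [lra|].
      replace (v0 / v c * - v c) with (- v0) by (field; assumption).
      unfold Rabs in *. repeat destruct Rcase_abs; lra. }
  (* This one estimate gives both the injectivity of [T] and the continuity of its inverse. *)
  assert (Hexp : forall x y, Rabs (y - x) <= 2 * Rabs v0 * Rabs (T y - T x)).
  { intros x y. destruct (Hslope x y) as [c E]. rewrite E, Rabs_mult, <- Rmult_assoc.
    rewrite <- (Rmult_1_l (Rabs (y - x))) at 1.
    apply Rmult_le_compat_r; [apply Rabs_pos|].
    rewrite Rabs_inv. apply Rmult_le_reg_r with (Rabs (v c)).
    - now apply Rabs_pos_lt.
    - rewrite Rmult_assoc, Rinv_l by now apply Rabs_no_R0. specialize (Hvx c). lra. }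
  assert (Hsurj : forall t, {x | T x = t}).
  { intros t. set (A := 2 * Rabs (v0 * t)).
    assert (HA : 0 <= A) by (pose proof (Rabs_pos (v0 * t)); unfold A; lra).
    assert (Hr : v0 * t <= v0 * T (x0 + A)).
    { destruct (Hslope x0 (x0 + A)) as [c E]. rewrite HT0 in E.
      replace (T (x0 + A)) with (/ v c * A) by (rewrite <- (Rminus_0_r (T (x0 + A))), E; ring).
      rewrite <- Rmult_assoc. pose proof (Rmult_le_compat_r A _ _ HA (Hratio c)) as H.
      unfold Rdiv in H. pose proof (Rle_abs (v0 * t)). unfold A in *. lra. }
    assert (Hl : v0 * T (x0 - A) <= v0 * t).
    { destruct (Hslope x0 (x0 - A)) as [c E]. rewrite HT0 in E.
      replace (T (x0 - A)) with (- (/ v c * A)) by (rewrite <- (Rminus_0_r (T (x0 - A))), E; ring).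
      rewrite <- Ropp_mult_distr_r, <- Rmult_assoc.
      pose proof (Rmult_le_compat_r A _ _ HA (Hratio c)) as H.
      unfold Rdiv in H. pose proof (Rle_abs (- (v0 * t))) as H'. rewrite Rabs_Ropp in H'.
      unfold A in *. lra. }
    destruct (IVT_gen (fun x => v0 * T x) (x0 - A) (x0 + A) (v0 * t)) as [x [_ Hx]].
    - intros x. apply continuity_pt_mult; [apply continuity_pt_const; now intros ? ? | apply HTc].
    - split; [apply Rle_trans with (2 := Hl); apply Rmin_l
             | apply Rle_trans with (1 := Hr); apply Rmax_r].
    - exists x. now apply Rmult_eq_reg_l with v0. }
  exists T, (fun t => proj1_sig (Hsurj t)).
  assert (HTX : forall t, T (proj1_sig (Hsurj t)) = t) by (intros t; apply proj2_sig).
  split; [exact HT0 | split; [exact HT | split]].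
  - intros x. apply Rminus_diag_uniq, Rabs_eq_0, Rle_antisym; [|apply Rabs_pos].
    apply Rle_trans with (1 := Hexp _ _).
    rewrite HTX, Rminus_diag, Rabs_R0. lra.
  - intros t. set (X := fun t => proj1_sig (Hsurj t)) in *.
    change (is_derive X t (v (X t))).
    (* The inverse is differentiated through T (X t) = t, that is with a = 0, b = / v (X t) and z =
       1. *)
    replace (v (X t)) with ((1 - 0) / (/ v (X t))) by (field; apply Hne).
    apply (implicit_derivative (fun _ y => T y)).
    + apply continuous_eps_delta. intros eps Heps. exists (eps / (2 * Rabs v0)).
      split; [apply Rdiv_lt_0_compat; lra|]. intros y Hy.
      apply Rle_lt_trans with (1 := Hexp _ _). unfold X. rewrite !HTX.
      apply (Rmult_lt_compat_l (2 * Rabs v0)) in Hy; [|lra].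
      replace (2 * Rabs v0 * (eps / (2 * Rabs v0))) with eps in Hy by (field; lra). exact Hy.
    + intros eps.
      destruct (proj1 (is_derive_eps_delta _ _ _) (HT (X t)) eps (cond_pos eps)) as [d [Hd H]].
      exists (mkposreal d Hd). simpl. intros x y _ Hy. specialize (H y Hy).
      replace (T y - T (X t) - (0 * (x - t) + / v (X t) * (y - X t)))
        with (T y - T (X t) - / v (X t) * (y - X t)) by ring.
      apply Rle_trans with (1 := H). apply Rmult_le_compat_l; [left; apply cond_pos | apply Rmax_r].
    + now apply Rinv_neq_0_compat.
    + apply is_derive_ext with (fun s => s).
      * intros s. symmetry. apply HTX.
      * apply (is_derive_id (K := R_AbsRing)).
Qed.

Lemma continuous_comp_2d (f : R -> R -> R) (g h : R -> R) (x : R) :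
  continuity_2d_pt f (g x) (h x) -> continuous g x -> continuous h x ->
  continuous (fun s => f (g s) (h s)) x.
Proof.
  intros Hf Hg Hh. apply (continuous_comp_2 g h f); trivial.
  now apply continuity_2d_pt_filterlim.
Qed.

Lemma differentiable_pt_lim_continuity (f : R -> R -> R) (x y a b : R) :
  differentiable_pt_lim f x y a b -> continuity_2d_pt f x y.
Proof. intros H. apply differentiable_continuity_pt. now exists a, b. Qed.

Lemma differentiable_pt_lim_is_derive_snd (f : R -> R -> R) (x y a b : R) :
  differentiable_pt_lim f x y a b -> is_derive (f x) y b.
Proof.
  intros H. apply is_derive_eps_delta. intros eps Heps.
  destruct (H (mkposreal eps Heps)) as [d Hd]. exists d. split; [apply cond_pos|].
  intros t Ht. specialize (Hd x t). simpl in Hd.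
  replace (f x t - f x y - b * (t - y)) with (f x t - f x y - (a * (x - x) + b * (t - y))) by ring.
  assert (Hx : Rabs (x - x) < d) by (rewrite Rminus_diag, Rabs_R0; apply cond_pos).
  apply Rle_trans with (1 := Hd Hx Ht). rewrite Rminus_diag, Rabs_R0.
  rewrite Rmax_right by apply Rabs_pos. lra.
Qed.

(** Nearest-point retraction onto the interval. Composing with it turns data on a box into
    continuous data on the whole line, so that no function spaces over intervals are needed. *)
Definition clamp (x0 r x : R) : R := Rmax (x0 - r) (Rmin (x0 + r) x).

Lemma clamp_close (x0 r x : R) : 0 <= r -> Rabs (clamp x0 r x - x0) <= r.
Proof.
  intros Hr. unfold clamp, Rmax, Rmin, Rabs.
  repeat destruct Rle_dec; destruct Rcase_abs; lra.
Qed.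

Lemma clamp_id (x0 r x : R) : Rabs (x - x0) <= r -> clamp x0 r x = x.
Proof.
  unfold clamp, Rmax, Rmin, Rabs. repeat destruct Rle_dec; destruct Rcase_abs; lra.
Qed.

Lemma clamp_continuous (x0 r x : R) : continuous (clamp x0 r) x.
Proof.
  apply continuous_eps_delta. intros eps Heps. exists eps. split; [exact Heps|].
  intros y. unfold clamp, Rmax, Rmin, Rabs.
  repeat destruct Rle_dec; repeat destruct Rcase_abs; lra.
Qed.

(** * Graphs along which a potential Th grows at the prescribed rate Q *)

Section SlopedGraph.

Variables (Th Tx Ty Q : R -> R -> R) (x0 y0 r K L : R).

Definition in_box (x y : R) : Prop := Rabs (x - x0) <= r /\ Rabs (y - y0) <= r.

Hypothesis hr : 0 < r.
Hypothesis hTh : forall x y, in_box x y -> differentiable_pt_lim Th x y (Tx x y) (Ty x y).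
Hypothesis hTy : forall x y, in_box x y -> Rabs (Ty x y - 1) <= / 2.
Hypothesis hQ : forall x y, in_box x y -> continuity_2d_pt Q x y.
Hypothesis hK : forall x y, in_box x y -> Rabs (Q x y) <= K.
Hypothesis hL : forall x y z, in_box x y -> in_box x z ->
  Rabs (Q x y - Q x z) <= L * Rabs (y - z).

Lemma in_box_center : in_box x0 y0.
Proof. split; rewrite Rminus_diag, Rabs_R0; lra. Qed.

Lemma in_box_between x y z t :
  in_box x y -> in_box x z -> Rmin y z <= t <= Rmax y z -> in_box x t.
Proof.
  intros [Hx Hy] [_ Hz] Ht. split; [exact Hx|].
  unfold Rmin, Rmax, Rabs in *. destruct Rle_dec; repeat destruct Rcase_abs; lra.
Qed.

Lemma vertical_mean_value x y z : in_box x y -> in_box x z ->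
  exists c, in_box x c /\ Th x z - Th x y = Ty x c * (z - y).
Proof.
  intros Hy Hz.
  destruct (mean_value (Th x) (Ty x) y z) as [c [Hc E]].
  - intros t Ht. apply differentiable_pt_lim_is_derive_snd with (Tx x t).
    apply hTh. now apply in_box_between with y z.
  - exists c. split; [|exact E]. now apply in_box_between with y z.
Qed.

(** The uniqueness estimate: points on a vertical line are recovered from their values of [Th]. *)
Lemma vertical_expand x y z : in_box x y -> in_box x z ->
  Rabs (z - y) <= 2 * Rabs (Th x z - Th x y).
Proof.
  intros Hy Hz. destruct (vertical_mean_value x y z Hy Hz) as [c [Hc E]].
  rewrite E, Rabs_mult. pose proof (hTy x c Hc) as H.
  assert (/ 2 <= Rabs (Ty x c)) by (unfold Rabs in *; repeat destruct Rcase_abs; lra).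
  pose proof (Rmult_le_compat_r (Rabs (z - y)) _ _ (Rabs_pos _) H0). lra.
Qed.

(** The existence estimate: y - Th(x, y) contracts by 1/2 on vertical lines. This is the reason for
    normalising [Ty] to be near 1. *)
Lemma vertical_contract x y z : in_box x y -> in_box x z ->
  Rabs (z - y - (Th x z - Th x y)) <= / 2 * Rabs (z - y).
Proof.
  intros Hy Hz. destruct (vertical_mean_value x y z Hy Hz) as [c [Hc E]].
  rewrite E. replace (z - y - Ty x c * (z - y)) with (- (Ty x c - 1) * (z - y)) by ring.
  rewrite Rabs_mult, Rabs_Ropp. apply Rmult_le_compat_r; [apply Rabs_pos | now apply hTy].
Qed.

Section Operator.

Variable r1 : R.
Hypothesis hr1 : 0 < r1 <= r.
Hypothesis hr1L : r1 * L <= / 4.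
Hypothesis hr1K : r1 * K <= r / 4.
Hypothesis hr1T : forall x, Rabs (x - x0) <= r1 -> Rabs (Th x y0 - Th x0 y0) <= r / 4.

Let c := clamp x0 r1.

(* The clamp makes the right-hand side globally defined; on [|x - x0| <= r1] the fixed
   points are the solutions of Th(x, f x) = Th(x0, y0) + int_{x0}^x Q(s, f s) ds. *)
Definition graph_step (f : R -> R) (x : R) : R :=
  f x - (Th (c x) (f x) - Th x0 y0 - RInt (fun s => Q (c s) (f s)) x0 (c x)).

Lemma clamped_in_box f x : admissible y0 r f -> in_box (c x) (f x).
Proof.
  intros [_ Hf]. split; [|apply Hf].
  apply Rle_trans with r1; [apply clamp_close|]; lra.
Qed.

Lemma graph_integrand_continuous f x :
  admissible y0 r f -> continuous (fun s => Q (c s) (f s)) x.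
Proof.
  intros Hf. apply continuous_comp_2d; [|apply clamp_continuous | apply Hf].
  apply hQ. now apply clamped_in_box.
Qed.

Lemma graph_integrable f a b : admissible y0 r f -> ex_RInt (fun s => Q (c s) (f s)) a b.
Proof.
  intros Hf. apply (ex_RInt_continuous (V := R_CompleteNormedModule)).
  intros z _. now apply graph_integrand_continuous.
Qed.

(** The deviation from [y0] splits into three parts: at most r/2 from [vertical_contract] between
    [y0] and [f x], r/4 from the variation of [Th] along the line y = y0, and r/4 from the
    integral. *)
Lemma graph_step_admissible f : admissible y0 r f -> admissible y0 r (graph_step f).
Proof.
  intros Hf. split; intros x.
  - apply (continuous_minus f); [apply Hf|].
    apply (continuous_minus (fun x => Th (c x) (f x) - Th x0 y0)).
    + apply (continuous_minus (fun x => Th (c x) (f x))); [|apply continuous_const].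
      apply continuous_comp_2d; [|apply clamp_continuous | apply Hf].
      apply differentiable_pt_lim_continuity with (Tx (c x) (f x)) (Ty (c x) (f x)).
      apply hTh. now apply clamped_in_box.
    + apply (continuous_comp c (fun y => RInt (fun s => Q (c s) (f s)) x0 y)).
      * apply clamp_continuous.
      * apply (ex_derive_continuous (fun y => RInt (fun s => Q (c s) (f s)) x0 y)).
        eexists. apply (is_derive_primitive (fun s => Q (c s) (f s))).
        intros t. now apply graph_integrand_continuous.
  - unfold graph_step.
    assert (Hc : Rabs (c x - x0) <= r1) by (apply clamp_close; lra).
    assert (H0 : in_box (c x) y0).
    { split; [lra | rewrite Rminus_diag, Rabs_R0; lra]. }
    pose proof (vertical_contract (c x) y0 (f x) H0 (clamped_in_box f x Hf)) as H1.
    pose proof (hr1T (c x) Hc) as H2.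
    assert (H3 : Rabs (RInt (fun s => Q (c s) (f s)) x0 (c x)) <= Rabs (c x - x0) * K).
    { apply abs_RInt_le_unordered; [now apply graph_integrable|].
      intros t _. now apply hK, clamped_in_box. }
    assert (0 <= K) by exact (Rle_trans _ _ _ (Rabs_pos _) (hK _ _ in_box_center)).
    pose proof (Rmult_le_compat_r K _ _ H Hc).
    pose proof (proj2 Hf x).
    generalize dependent (RInt (fun s => Q (c s) (f s)) x0 (c x)). intros I HI.
    assert (Rabs I <= r / 4) by lra.
    unfold Rabs in *. repeat destruct Rcase_abs; lra.
Qed.

(** The factor 3/4 is 1/2 from [vertical_contract] plus r1 * L <= 1/4 from the integral of the
    Lipschitz function [Q]. *)
Lemma graph_step_contracts f g e : admissible y0 r f -> admissible y0 r g -> 0 <= e ->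
  (forall x, Rabs (f x - g x) <= e) ->
  forall x, Rabs (graph_step f x - graph_step g x) <= 3 / 4 * e.
Proof.
  intros Hf Hg He Hfg x. unfold graph_step.
  assert (Hc : Rabs (c x - x0) <= r1) by (apply clamp_close; lra).
  pose proof (vertical_contract (c x) (g x) (f x)
    (clamped_in_box g x Hg) (clamped_in_box f x Hf)) as H1.
  (* The sign of [L] is read off from [hL] at the centre and the top of the box. *)
  assert (HL : 0 <= L).
  { destruct (Rle_dec 0 L) as [|HL]; trivial. exfalso.
    assert (Hb : in_box x0 (y0 + r)).
    { split; [rewrite Rminus_diag, Rabs_R0; lra|].
      replace (y0 + r - y0) with r by ring. rewrite Rabs_pos_eq; lra. }
    pose proof (hL x0 (y0 + r) y0 Hb in_box_center) as H.
    pose proof (Rabs_pos (Q x0 (y0 + r) - Q x0 y0)).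
    replace (y0 + r - y0) with r in H by ring. rewrite (Rabs_pos_eq r) in H by lra.
    pose proof (Rmult_lt_0_compat (- L) r). lra. }
  assert (H2 : Rabs (RInt (fun s => Q (c s) (f s)) x0 (c x) -
    RInt (fun s => Q (c s) (g s)) x0 (c x)) <= Rabs (c x - x0) * (L * e)).
  { change (RInt (fun s => Q (c s) (f s)) x0 (c x) - RInt (fun s => Q (c s) (g s)) x0 (c x))
      with (minus (RInt (fun s => Q (c s) (f s)) x0 (c x))
        (RInt (fun s => Q (c s) (g s)) x0 (c x))).
    rewrite <- (RInt_minus (V := R_CompleteNormedModule)) by now apply graph_integrable.
    apply abs_RInt_le_unordered.
    - apply (ex_RInt_minus (V := R_NormedModule)); now apply graph_integrable.
    - intros t _.
      apply Rle_trans with (1 := hL (c t) (f t) (g t)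
        (clamped_in_box f t Hf) (clamped_in_box g t Hg)).
      now apply Rmult_le_compat_l. }
  assert (H3 : Rabs (c x - x0) * (L * e) <= e / 4).
  { apply Rle_trans with (r1 * (L * e)).
    - apply Rmult_le_compat_r; [now apply Rmult_le_pos | exact Hc].
    - pose proof (Rmult_le_compat_r e _ _ He hr1L). lra. }
  specialize (Hfg x).
  generalize dependent (RInt (fun s => Q (c s) (f s)) x0 (c x)). intros I.
  generalize (RInt (fun s => Q (c s) (g s)) x0 (c x)). intros I' HI.
  apply Rle_trans with (/ 2 * Rabs (f x - g x) + e / 4); [|lra].
  replace (f x - (Th (c x) (f x) - Th x0 y0 - I) - (g x - (Th (c x) (g x) - Th x0 y0 - I')))
    with ((f x - g x - (Th (c x) (f x) - Th (c x) (g x))) + (I - I')) by ring.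
  apply Rle_trans with (1 := Rabs_triang _ _). lra.
Qed.

(** The right side of the fixed point equation is the primitive of a continuous function, so Th(x, f
    x) is differentiable even though [f] is so far only continuous; [implicit_derivative] then
    passes this on to [f]. The first derivative serves the comparison with other curves, the second
    shows that the graph carries a solution. *)
Lemma graph_exists : exists f, admissible y0 r f /\ f x0 = y0 /\
  (forall x, Rabs (x - x0) < r1 -> is_derive (fun s => Th s (f s)) x (Q x (f x))) /\
  (forall x, Rabs (x - x0) < r1 -> is_derive f x ((Q x (f x) - Tx x (f x)) / Ty x (f x))).
Proof.
  destruct (contraction_fixed_point y0 r (3 / 4) graph_step) as [f [Hf Hfix]];
    [lra | lra | apply graph_step_admissible | apply graph_step_contracts |].
  assert (Heq : forall x, Th (c x) (f x) = Th x0 y0 + RInt (fun s => Q (c s) (f s)) x0 (c x)).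
  { intros x. specialize (Hfix x). unfold graph_step in Hfix. lra. }
  exists f. split; [exact Hf|].
  assert (Hd : forall x, Rabs (x - x0) < r1 -> is_derive (fun s => Th s (f s)) x (Q x (f x))).
  { intros x Hx.
    apply is_derive_ext_loc with (fun y => Th x0 y0 + RInt (fun s => Q (c s) (f s)) x0 y).
    - assert (He : 0 < r1 - Rabs (x - x0)) by lra.
      exists (mkposreal _ He). intros y Hy. change (Rabs (y - x) < r1 - Rabs (x - x0)) in Hy.
      specialize (Heq y). unfold c in Heq at 1 3. rewrite clamp_id in Heq; [now symmetry|].
      unfold Rabs in *; repeat destruct Rcase_abs; lra.
    - replace (Q x (f x)) with (plus zero (Q (c x) (f x))).
      + apply (is_derive_plus (fun _ => Th x0 y0)).
        * apply (is_derive_const (K := R_AbsRing) (V := R_NormedModule)).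
        * apply (is_derive_primitive (fun s => Q (c s) (f s))).
          intros t. now apply graph_integrand_continuous.
      + rewrite plus_zero_l. unfold c. now rewrite clamp_id by lra. }
  split; [|split; [exact Hd|]].
  - assert (Hc : c x0 = x0).
    { apply clamp_id. rewrite Rminus_diag, Rabs_R0. lra. }
    specialize (Heq x0). rewrite Hc, RInt_point in Heq. change zero with 0 in Heq.
    pose proof (clamped_in_box f x0 Hf) as Hb. rewrite Hc in Hb.
    pose proof (vertical_expand x0 y0 (f x0) in_box_center Hb) as H.
    replace (Th x0 (f x0) - Th x0 y0) with 0 in H by lra. rewrite Rabs_R0 in H.
    apply Rminus_diag_uniq, Rabs_eq_0. pose proof (Rabs_pos (f x0 - y0)). lra.
  - intros x Hx.
    assert (Hb : in_box x (f x)) by (split; [lra | apply Hf]).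
    apply (implicit_derivative Th); [apply Hf | now apply hTh | | now apply Hd].
    intros E. pose proof (hTy x (f x) Hb) as H. rewrite E in H.
    unfold Rabs in H. destruct Rcase_abs; lra.
Qed.

End Operator.

End SlopedGraph.

(** * Planar fields with a transversal potential *)

Definition solves (V1 V2 : R -> R -> R) (D : R -> R -> Prop) (J : R -> Prop)
    (xi zeta : R -> R) : Prop :=
  (forall a b t, J a -> J b -> a <= t <= b -> J t) /\
  (forall t, J t -> D (xi t) (zeta t) /\
    is_derive xi t (V1 (xi t) (zeta t)) /\ is_derive zeta t (V2 (xi t) (zeta t))).

Definition has_unique_solution (V1 V2 : R -> R -> R) (D : R -> R -> Prop) (x0 y0 : R) : Prop :=
  exists (I : R -> Prop) (X Y : R -> R),
    open I /\ solves V1 V2 D I X Y /\ I 0 /\ X 0 = x0 /\ Y 0 = y0 /\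
    forall (J : R -> Prop) (xi zeta : R -> R) (s : R),
      solves V1 V2 D J xi zeta -> J s -> xi s = x0 -> zeta s = y0 ->
      forall t, J t -> I (t - s) /\ xi t = X (t - s) /\ zeta t = Y (t - s).

(* Quantifying over all small open sets makes the property invariant under exchange of the
   coordinates and independent of the shape of the discs. *)
Definition locally_uniquely_solvable (V1 V2 : R -> R -> R) (x0 y0 : R) : Prop :=
  exists r, 0 < r /\ forall D : R -> R -> Prop,
    (forall x y, D x y -> locally_2d D x y) -> D x0 y0 ->
    (forall x y, D x y -> Rabs (x - x0) < r /\ Rabs (y - y0) < r) ->
    has_unique_solution V1 V2 D x0 y0.

Lemma locally_2d_swap (P : R -> R -> Prop) (x y : R) :
  locally_2d P x y -> locally_2d (fun a b => P b a) y x.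
Proof. intros [d Hd]. exists d. intros u v Hu Hv. now apply Hd. Qed.

Lemma locally_uniquely_solvable_swap (V1 V2 : R -> R -> R) (x0 y0 : R) :
  locally_uniquely_solvable (fun x y => V2 y x) (fun x y => V1 y x) y0 x0 ->
  locally_uniquely_solvable V1 V2 x0 y0.
Proof.
  intros [r [Hr H]]. exists r. split; [exact Hr|]. intros D Ho Hp HD.
  destruct (H (fun a b => D b a)) as (I & X & Y & HIo & HS & HI0 & HX & HY & HU); trivial.
  - intros x y Hxy. apply locally_2d_swap. now apply Ho.
  - intros x y Hxy. destruct (HD y x Hxy). now split.
  - exists I, Y, X. split; [exact HIo|]. split.
    + split; [apply HS|]. intros t Ht. destruct (proj2 HS t Ht) as [? [? ?]]. split; [|split]; assumption.
    + split; [exact HI0|]. split; [exact HY|]. split; [exact HX|].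
      intros J xi zeta s [HJ HS'] Hs Hxi Hzeta t Ht.
      destruct (HU J zeta xi s) with (t := t) as [? [? ?]]; trivial; [|now repeat split].
      split; [exact HJ|]. intros t' Ht'. destruct (HS' t' Ht') as [? [? ?]]. split; [|split]; assumption.
Qed.

(** The set of such [t] is the component of 0 in the set of times at which (X, Y) lies in [D]. The
    flow exists for all times, but a solution in [D] must live on an interval, and this is the
    largest one. *)
Definition stays_in (D : R -> R -> Prop) (X Y : R -> R) (t : R) : Prop :=
  forall s, Rmin 0 t <= s <= Rmax 0 t -> D (X s) (Y s).

Lemma stays_in_open (D : R -> R -> Prop) (X Y : R -> R) :
  (forall x y, D x y -> locally_2d D x y) ->
  (forall t, continuous X t) -> (forall t, continuous Y t) -> open (stays_in D X Y).
Proof.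
  intros Ho HX HY t Ht.
  assert (HD : D (X t) (Y t)).
  { apply Ht. unfold Rmin, Rmax. destruct Rle_dec; lra. }
  destruct (Ho _ _ HD) as [d Hd].
  destruct (proj1 (continuous_eps_delta _ _) (HX t) d (cond_pos d)) as [d1 [Hd1 H1]].
  destruct (proj1 (continuous_eps_delta _ _) (HY t) d (cond_pos d)) as [d2 [Hd2 H2]].
  exists (mkposreal _ (Rmin_pos _ _ Hd1 Hd2)). intros t' Ht'.
  change (Rabs (t' - t) < Rmin d1 d2) in Ht'. apply Rmin_Rgt in Ht' as [Ht1 Ht2].
  intros s Hs.
  destruct (Rle_dec (Rmin 0 t) s); [destruct (Rle_dec s (Rmax 0 t))|]; [now apply Ht | |].
  all: apply Hd; [apply H1 | apply H2]; unfold Rmin, Rmax, Rabs in *;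
    repeat destruct Rle_dec; repeat destruct Rcase_abs; lra.
Qed.

Lemma stays_in_convex (D : R -> R -> Prop) (X Y : R -> R) (a b t : R) :
  stays_in D X Y a -> stays_in D X Y b -> a <= t <= b -> stays_in D X Y t.
Proof.
  intros Ha Hb Ht s Hs.
  destruct (Rle_dec 0 t); [apply Hb | apply Ha];
    unfold Rmin, Rmax in *; repeat destruct Rle_dec; lra.
Qed.

Section TransversalPotential.

Variables (Th Tx Ty Q V1 V2 : R -> R -> R) (x0 y0 r K L v0 : R).

Let in_box := in_box x0 y0 r.

Hypothesis hr : 0 < r.
Hypothesis hTh : forall x y, in_box x y -> differentiable_pt_lim Th x y (Tx x y) (Ty x y).
Hypothesis hTy : forall x y, in_box x y -> Rabs (Ty x y - 1) <= / 2.
Hypothesis hQ : forall x y, in_box x y -> continuity_2d_pt Q x y.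
Hypothesis hK : forall x y, in_box x y -> Rabs (Q x y) <= K.
Hypothesis hL : forall x y z, in_box x y -> in_box x z ->
  Rabs (Q x y - Q x z) <= L * Rabs (y - z).
Hypothesis hv0 : v0 <> 0.
Hypothesis hV1c : forall x y, in_box x y -> continuity_2d_pt V1 x y.
Hypothesis hV1 : forall x y, in_box x y -> Rabs (V1 x y - v0) <= Rabs v0 / 2.
Hypothesis hThV : forall x y, in_box x y -> Tx x y * V1 x y + Ty x y * V2 x y = Q x y * V1 x y.

Lemma small_radius : exists r1, 0 < r1 <= r /\ r1 * L <= / 4 /\ r1 * K <= r / 4 /\
  forall x, Rabs (x - x0) <= r1 -> Rabs (Th x y0 - Th x0 y0) <= r / 4.
Proof.
  pose proof (in_box_center x0 y0 r hr) as Hc.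
  pose proof (differentiable_pt_lim_continuity _ _ _ _ _ (hTh _ _ Hc)) as HTc.
  assert (Hr4 : 0 < r / 4) by lra.
  destruct (HTc (mkposreal _ Hr4)) as [d Hd]. simpl in Hd.
  pose proof (Rabs_pos L) as HL0. pose proof (Rabs_pos K) as HK0.
  pose proof (Rle_abs L) as HLa. pose proof (Rle_abs K) as HKa.
  set (a := / (4 * (Rabs L + 1))). set (b := r / (4 * (Rabs K + 1))).
  assert (Ha : 0 < a) by (apply Rinv_0_lt_compat; lra).
  assert (Hb : 0 < b) by (apply Rdiv_lt_0_compat; lra).
  assert (Hd2 : 0 < d / 2) by (pose proof (cond_pos d); lra).
  set (r1 := Rmin (Rmin r (d / 2)) (Rmin a b)).
  assert (Hr1 : 0 < r1) by (repeat apply Rmin_pos; assumption).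
  assert (Hr1r : r1 <= r) by (unfold r1; eapply Rle_trans; [apply Rmin_l | apply Rmin_l]).
  assert (Hr1d : r1 <= d / 2) by (unfold r1; eapply Rle_trans; [apply Rmin_l | apply Rmin_r]).
  assert (Hr1a : r1 <= a) by (unfold r1; eapply Rle_trans; [apply Rmin_r | apply Rmin_l]).
  assert (Hr1b : r1 <= b) by (unfold r1; eapply Rle_trans; [apply Rmin_r | apply Rmin_r]).
  exists r1. split; [lra|]. split; [|split].
  - apply Rle_trans with (a * (Rabs L + 1)).
    + apply Rle_trans with (r1 * (Rabs L + 1)).
      * apply Rmult_le_compat_l; lra.
      * apply Rmult_le_compat_r; lra.
    + right. unfold a. field. lra.
  - apply Rle_trans with (b * (Rabs K + 1)).
    + apply Rle_trans with (r1 * (Rabs K + 1)).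
      * apply Rmult_le_compat_l; lra.
      * apply Rmult_le_compat_r; lra.
    + right. unfold b. field. lra.
  - intros x Hx. left. apply Hd; [lra | rewrite Rminus_diag, Rabs_R0; apply cond_pos].
Qed.

Lemma locally_uniquely_solvable_normalised : locally_uniquely_solvable V1 V2 x0 y0.
Proof.
  destruct small_radius as (r1 & Hr1 & Hr1L & Hr1K & Hr1T).
  destruct (graph_exists Th Tx Ty Q x0 y0 r K L hr hTh hTy hQ hK hL r1 Hr1 Hr1L Hr1K Hr1T)
    as (f & Hf & Hf0 & HTf & Hdf).
  set (c := clamp x0 r1).
  assert (Hbox : forall x, in_box (c x) (f x)) by
    (intros x; now apply (clamped_in_box x0 y0 r r1 Hr1)).
  (* On the graph of [f] the horizontal coordinate obeys a scalar equation. The clamp keeps its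
     speed within |v0|/2 of [v0] on the whole line; inside [D] the clamp is the identity. *)
  destruct (autonomous_flow (fun x => V1 (c x) (f x)) v0 x0 hv0) as (T & X & HT0 & HT & HXT & HX).
  { intros x. apply continuous_comp_2d; [now apply hV1c | apply clamp_continuous | apply Hf]. }
  { intros x. now apply hV1. }
  exists r1. split; [lra|]. intros D Ho Hp HD.
  assert (HDbox : forall x y, D x y -> in_box x y).
  { intros x y Hxy. destruct (HD x y Hxy). split; lra. }
  assert (HDc : forall x y, D x y -> c x = x).
  { intros x y Hxy. apply clamp_id. destruct (HD x y Hxy). lra. }
  assert (HDf : forall x y, D x y -> in_box x (f x)).
  { intros x y Hxy. pose proof (Hbox x) as H. now rewrite (HDc x y Hxy) in H. }
  assert (HXc : forall t, continuous X t).
  { intros t. apply (ex_derive_continuous X). eexists. apply HX. }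
  assert (HX0 : X 0 = x0) by (rewrite <- HT0; apply HXT).
  set (Y := fun t => f (X t)).
  exists (stays_in D X Y), X, Y.
  split; [apply stays_in_open; trivial|].
  { intros t. apply (continuous_comp X f); [apply HXc | apply Hf]. }
  (* The chain rule gives Y' = f'(X) V1 = (Q - Tx) / Ty * V1, which equals V2 by [hThV]. *)
  assert (Hgraph : forall t, D (X t) (Y t) ->
    is_derive X t (V1 (X t) (Y t)) /\ is_derive Y t (V2 (X t) (Y t))).
  { intros t Ht. pose proof (HX t) as HXt. simpl in HXt. rewrite (HDc _ _ Ht) in HXt.
    split; [exact HXt|].
    pose proof (HDbox _ _ Ht) as Hb. unfold Y in *.
    replace (V2 (X t) (f (X t))) with (scal (V1 (X t) (f (X t)))
      ((Q (X t) (f (X t)) - Tx (X t) (f (X t))) / Ty (X t) (f (X t)))).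
    - apply (is_derive_comp f X); [|exact HXt]. apply Hdf. now apply (HD (X t) (f (X t))).
    - change scal with Rmult. pose proof (hTy _ _ Hb) as HTyb. pose proof (hThV _ _ Hb) as E.
      assert (Ty (X t) (f (X t)) <> 0).
      { intros E0. rewrite E0 in HTyb. unfold Rabs in HTyb. destruct Rcase_abs; lra. }
      apply Rmult_eq_reg_r with (Ty (X t) (f (X t))); trivial.
      unfold Rdiv. rewrite !Rmult_assoc, Rinv_l by assumption. lra. }
  split; [split|].
  { intros a b t. apply stays_in_convex. }
  { intros t Ht.
    assert (HDt : D (X t) (Y t)) by (apply Ht; unfold Rmin, Rmax; destruct Rle_dec; lra).
    split; [exact HDt | now apply Hgraph]. }
  split.
  { intros s Hs. rewrite Rmin_left, Rmax_left in Hs by lra.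
    replace s with 0 by lra. unfold Y. now rewrite HX0, Hf0. }
  split; [exact HX0|]. split; [unfold Y; now rewrite HX0|].
  intros J xi zeta s [HJ Hsol] Hs Hxi Hzeta.
  (* Along the curve the potential and its value on the graph of [f] below it grow with rates
     Q(xi, zeta) xi' and Q(xi, f xi) xi', whose difference is controlled by the gap itself. *)
  assert (Hzf : forall t, J t -> Th (xi t) (zeta t) - Th (xi t) (f (xi t)) = 0).
  (* In the Gronwall constant, |L| is the Lipschitz bound of [Q], the first 2 converts a gap in y
     into a gap in [Th], and 2 |v0| bounds [V1]. *)
  { apply gronwall_zero with (fun t => Q (xi t) (zeta t) * V1 (xi t) (zeta t) -
        Q (xi t) (f (xi t)) * V1 (xi t) (zeta t)) (Rabs L * 2 * (2 * Rabs v0)) s; trivial.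
    - intros t Ht. destruct (Hsol t Ht) as (HDt & Hdxi & Hdzeta).
      pose proof (HDbox _ _ HDt) as Hb.
      apply (is_derive_minus (fun t => Th (xi t) (zeta t)) (fun t => Th (xi t) (f (xi t)))).
      + rewrite <- hThV by exact Hb. apply is_derive_Reals.
        apply derivable_pt_lim_comp_2d; [now apply hTh | now apply is_derive_Reals ..].
      + rewrite Rmult_comm.
        apply (is_derive_comp (fun x => Th x (f x)) xi); [|exact Hdxi].
        apply HTf. now apply (HD _ _ HDt).
    - intros t Ht. destruct (Hsol t Ht) as (HDt & _ & _).
      pose proof (HDbox _ _ HDt) as Hb.
      pose proof (HDf _ _ HDt) as Hbf.
      rewrite <- Rmult_minus_distr_r, Rabs_mult.
      pose proof (hL _ _ _ Hb Hbf) as H1.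
      pose proof (vertical_expand Th Tx Ty x0 y0 r hr hTh hTy _ _ _ Hbf Hb) as H2.
      pose proof (hV1 _ _ Hb) as H3.
      assert (H4 : Rabs (V1 (xi t) (zeta t)) <= 2 * Rabs v0).
      { unfold Rabs in *; repeat destruct Rcase_abs; lra. }
      pose proof (Rabs_pos (zeta t - f (xi t))) as H5.
      pose proof (Rmult_le_compat_r _ _ _ H5 (Rle_abs L)) as H6.
      pose proof (Rmult_le_compat_l _ _ _ (Rabs_pos L) H2) as H7.
      apply Rle_trans with (Rabs L * (2 * Rabs (Th (xi t) (zeta t) - Th (xi t) (f (xi t))))
        * (2 * Rabs v0)); [|right; ring].
      apply Rmult_le_compat; try apply Rabs_pos; lra.
    - rewrite Hxi, Hzeta, Hf0. ring. }
  assert (Hz : forall t, J t -> zeta t = f (xi t)).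
  { intros t Ht. destruct (Hsol t Ht) as (HDt & _ & _).
    pose proof (HDf _ _ HDt) as Hbf.
    pose proof (vertical_expand Th Tx Ty x0 y0 r hr hTh hTy _ _ _ Hbf (HDbox _ _ HDt)) as H.
    rewrite (Hzf t Ht), Rabs_R0 in H. pose proof (Rabs_pos (zeta t - f (xi t))).
    apply Rminus_diag_uniq, Rabs_eq_0. lra. }
  (* In the time coordinate [T] the curve moves at unit speed, so this difference has derivative
     zero; Gronwall with constant 0 makes it vanish. *)
  assert (HTt : forall t, J t -> T (xi t) - (t - s) = 0).
  { apply gronwall_zero with (fun _ => 0) 0 s; trivial.
    - intros t Ht. destruct (Hsol t Ht) as (HDt & Hdxi & _).
      assert (Hv : V1 (xi t) (zeta t) <> 0).
      { intros E. pose proof (hV1 _ _ (HDbox _ _ HDt)) as H. rewrite E in H.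
        pose proof (Rabs_pos_lt v0 hv0).
        unfold Rabs in *; repeat destruct Rcase_abs; lra. }
      replace 0 with (minus (V1 (xi t) (zeta t) * / V1 (xi t) (zeta t)) 1).
      + apply (is_derive_minus (fun t => T (xi t)) (fun t => t - s)).
        * apply (is_derive_comp T xi); [|exact Hdxi].
          pose proof (HT (xi t)) as H. simpl in H.
          rewrite (HDc _ _ HDt) in H. now rewrite <- (Hz t Ht) in H.
        * auto_derive; trivial.
      + change (V1 (xi t) (zeta t) * / V1 (xi t) (zeta t) - 1 = 0). field. exact Hv.
    - intros t _. rewrite Rabs_R0. lra.
    - rewrite Hxi, HT0. ring. }
  assert (Hx : forall t, J t -> xi t = X (t - s)).
  { intros t Ht. replace (t - s) with (T (xi t)) by (pose proof (HTt t Ht); lra). now rewrite HXT. }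
  intros t Ht. split; [|split].
  (* Each time between 0 and t - s is the shift of a time between [s] and [t], which lies in [J];
     there the given curve is in [D] and agrees with (X, Y). *)
  - intros t' Ht'.
    assert (HJ' : J (t' + s)).
    { destruct (Rle_dec 0 (t - s)).
      - apply (HJ s t); trivial. rewrite Rmin_left, Rmax_right in Ht'; lra.
      - apply (HJ t s); trivial. rewrite Rmin_right, Rmax_left in Ht'; lra. }
    destruct (Hsol _ HJ') as (HDt & _). unfold Y.
    pose proof (Hx _ HJ') as E1. pose proof (Hz _ HJ') as E2.
    replace (t' + s - s) with t' in E1 by ring. now rewrite <- E1, <- E2.
  - now apply Hx.
  - unfold Y. rewrite <- Hx by trivial. now apply Hz.
Qed.

End TransversalPotential.

Lemma differentiable_pt_lim_scal (f : R -> R -> R) (x y a b k : R) :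
  differentiable_pt_lim f x y a b ->
  differentiable_pt_lim (fun u v => k * f u v) x y (k * a) (k * b).
Proof.
  intros H eps.
  assert (Hk : 0 < Rabs k + 1) by (pose proof (Rabs_pos k); lra).
  assert (He : 0 < eps / (Rabs k + 1)) by (apply Rdiv_lt_0_compat; [apply cond_pos | exact Hk]).
  destruct (H (mkposreal _ He)) as [d Hd]. exists d. intros u v Hu Hv.
  specialize (Hd u v Hu Hv). simpl in Hd.
  replace (k * f u v - k * f x y - (k * a * (u - x) + k * b * (v - y)))
    with (k * (f u v - f x y - (a * (u - x) + b * (v - y)))) by ring.
  rewrite Rabs_mult. set (m := Rmax (Rabs (u - x)) (Rabs (v - y))) in *.
  apply Rle_trans with ((Rabs k + 1) * (eps / (Rabs k + 1) * m)).
  - apply Rmult_le_compat; try apply Rabs_pos; lra.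
  - right. field. lra.
Qed.

Lemma continuity_2d_pt_near (f : R -> R -> R) (x y e : R) :
  continuity_2d_pt f x y -> 0 < e -> locally_2d (fun u v => Rabs (f u v - f x y) < e) x y.
Proof. intros H He. exact (H (mkposreal e He)). Qed.

(** Dividing [Th] and [Q] by the value of [Ty] at the centre scales the vertical slope to 1 there
    and preserves the relation with [V1], [V2]. Continuity then supplies the bounds of the
    normalised case on a small box. *)
Lemma transversal_potential_uniquely_solvable (Th Tx Ty Q V1 V2 : R -> R -> R) (x0 y0 L : R)
    (d : posreal) :
  locally_2d (fun x y => differentiable_pt_lim Th x y (Tx x y) (Ty x y) /\
    continuity_2d_pt Q x y /\ continuity_2d_pt V1 x y /\
    Tx x y * V1 x y + Ty x y * V2 x y = Q x y * V1 x y) x0 y0 ->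
  continuity_2d_pt Ty x0 y0 -> Ty x0 y0 <> 0 -> V1 x0 y0 <> 0 ->
  (forall x y z, Rabs (x - x0) < d -> Rabs (y - y0) < d -> Rabs (z - y0) < d ->
    Rabs (Q x y - Q x z) <= L * Rabs (y - z)) ->
  locally_uniquely_solvable V1 V2 x0 y0.
Proof.
  intros Hloc HTy Hb Hv HL.
  destruct (locally_2d_singleton _ _ _ Hloc) as (_ & HQ0 & HV0 & _).
  set (b := Ty x0 y0) in *. set (v0 := V1 x0 y0) in *.
  pose proof (Rabs_pos_lt b Hb) as Hb'. pose proof (Rabs_pos_lt v0 Hv) as Hv'.
  destruct (continuity_2d_pt_near Ty x0 y0 (Rabs b / 2) HTy) as [d1 H1]; [lra|].
  destruct (continuity_2d_pt_near V1 x0 y0 (Rabs v0 / 2) HV0) as [d2 H2]; [lra|].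
  destruct (continuity_2d_pt_near Q x0 y0 1 HQ0) as [d3 H3]; [lra|].
  destruct Hloc as [d4 H4].
  (* The closed box of radius m/2 lies inside all the open squares at once. *)
  set (m := Rmin d (Rmin (Rmin d1 d2) (Rmin d3 d4))).
  assert (Hm : 0 < m) by (repeat apply Rmin_pos; apply cond_pos).
  assert (Hmd : forall z, Rabs z <= m / 2 ->
    Rabs z < d /\ Rabs z < d1 /\ Rabs z < d2 /\ Rabs z < d3 /\ Rabs z < d4).
  { intros z Hz. assert (Hz' : Rabs z < m) by lra. clear -Hz'.
    apply Rmin_Rgt in Hz' as [H0 Hz']. apply Rmin_Rgt in Hz' as [H1 H2].
    apply Rmin_Rgt in H1 as [H1 H1']. apply Rmin_Rgt in H2 as [H2 H2'].
    repeat split; assumption. }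
  assert (Hib : 0 <= Rabs (/ b)) by apply Rabs_pos.
  apply (locally_uniquely_solvable_normalised (fun x y => / b * Th x y)
    (fun x y => / b * Tx x y) (fun x y => / b * Ty x y) (fun x y => / b * Q x y) V1 V2 x0 y0
    (m / 2) (Rabs (/ b) * (Rabs (Q x0 y0) + 1)) (Rabs (/ b) * L) v0); trivial; [lra | ..].
  - intros x y [Hx Hy]. apply differentiable_pt_lim_scal.
    apply Hmd in Hx, Hy. now apply H4.
  - intros x y [Hx Hy]. apply Hmd in Hx, Hy.
    replace (/ b * Ty x y - 1) with (/ b * (Ty x y - b)) by (field; exact Hb).
    rewrite Rabs_mult, Rabs_inv. apply Rmult_le_reg_l with (Rabs b); trivial.
    rewrite <- Rmult_assoc, Rinv_r, Rmult_1_l by lra.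
    left. now apply H1.
  - intros x y [Hx Hy]. apply continuity_2d_pt_mult; [apply continuity_2d_pt_const|].
    apply Hmd in Hx, Hy. now apply H4.
  - intros x y [Hx Hy]. apply Hmd in Hx, Hy.
    rewrite Rabs_mult. apply Rmult_le_compat_l; trivial.
    apply Rabs_le_near. left. now apply H3.
  - intros x y z [Hx Hy] [_ Hz]. apply Hmd in Hx, Hy, Hz.
    rewrite <- Rmult_minus_distr_l, Rabs_mult, Rmult_assoc.
    apply Rmult_le_compat_l; trivial. now apply HL.
  - intros x y [Hx Hy]. apply Hmd in Hx, Hy. now apply H4.
  - intros x y [Hx Hy]. apply Hmd in Hx, Hy. left. now apply H2.
  - intros x y [Hx Hy]. apply Hmd in Hx, Hy.
    assert (E : Tx x y * V1 x y + Ty x y * V2 x y = Q x y * V1 x y) by now apply H4.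
    rewrite !Rmult_assoc, <- E. ring.
Qed.

(** * The potential of a perturbed gradient *)

Definition partial_x (f : R -> R -> R) (x y : R) : R := Derive (fun s => f s y) x.

Definition partial_y (f : R -> R -> R) (x y : R) : R := Derive (fun s => f x s) y.

Definition C1_at (f : R -> R -> R) (x y : R) : Prop :=
  ex_derive (fun s => f s y) x /\ ex_derive (fun s => f x s) y /\
  continuity_2d_pt (partial_x f) x y /\ continuity_2d_pt (partial_y f) x y.

Lemma locally_2d_open_square (P : R -> R -> Prop) (x0 y0 d x y : R) :
  (forall u v, Rabs (u - x0) < d -> Rabs (v - y0) < d -> P u v) ->
  Rabs (x - x0) < d -> Rabs (y - y0) < d -> locally_2d P x y.
Proof.
  intros H Hx Hy.
  assert (He : 0 < Rmin (d - Rabs (x - x0)) (d - Rabs (y - y0))) by (apply Rmin_pos; lra).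
  exists (mkposreal _ He). simpl. intros u v Hu Hv.
  apply Rmin_Rgt in Hu as [Hu _]. apply Rmin_Rgt in Hv as [_ Hv].
  apply H; unfold Rabs in *; repeat destruct Rcase_abs; lra.
Qed.

Lemma between_close (y0 d y z t : R) :
  Rabs (y - y0) < d -> Rabs (z - y0) < d -> Rmin y z <= t <= Rmax y z -> Rabs (t - y0) < d.
Proof.
  unfold Rmin, Rmax, Rabs. repeat destruct Rle_dec; repeat destruct Rcase_abs; lra.
Qed.

Lemma differentiable_pt_lim_partials (f : R -> R -> R) (Fx : R -> R -> R) (x y fy : R) :
  locally_2d (fun u v => is_derive (fun s => f s v) u (Fx u v)) x y ->
  is_derive (fun s => f x s) y fy -> continuity_2d_pt Fx x y ->
  differentiable_pt_lim f x y (Fx x y) fy.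
Proof.
  intros H1 H2 H3. apply filterdiff_differentiable_pt_lim.
  apply (is_derive_filterdiff f x y Fx fy); trivial.
  - now apply locally_2d_locally in H1.
  - now apply continuity_2d_pt_filterlim.
Qed.

Lemma C1_differentiable (f : R -> R -> R) (x y : R) :
  locally_2d (C1_at f) x y -> differentiable_pt_lim f x y (partial_x f x y) (partial_y f x y).
Proof.
  intros H. destruct (locally_2d_singleton _ _ _ H) as (_ & Hy & Hc & _).
  apply differentiable_pt_lim_partials; trivial.
  - revert H. apply locally_2d_impl, locally_2d_forall. intros u v (Hu & _).
    now apply Derive_correct.
  - now apply Derive_correct.
Qed.

Lemma continuity_2d_pt_section (f : R -> R -> R) (x y : R) :
  continuity_2d_pt f x y -> continuous (fun t => f x t) y.
Proof.
  intros H. apply (continuous_comp_2d f (fun _ => x) (fun t => t)); trivial.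
  - apply continuous_const.
  - apply continuous_id.
Qed.

Section VerticalPrimitive.

Variables (f : R -> R -> R) (x0 y0 d : R).

Hypothesis hf : forall x y, Rabs (x - x0) < d -> Rabs (y - y0) < d -> continuity_2d_pt f x y.

Definition vertical_primitive (x y : R) : R := RInt (fun t => f x t) y0 y.

Lemma vertical_integrable x a b :
  Rabs (x - x0) < d -> Rabs (a - y0) < d -> Rabs (b - y0) < d -> ex_RInt (fun t => f x t) a b.
Proof.
  intros Hx Ha Hb. apply (ex_RInt_continuous (V := R_CompleteNormedModule)). intros t Ht.
  apply continuity_2d_pt_section, hf; trivial. now apply between_close with a b.
Qed.

Lemma base_close x : Rabs (x - x0) < d -> Rabs (y0 - y0) < d.
Proof. intros H. rewrite Rminus_diag, Rabs_R0. pose proof (Rabs_pos (x - x0)). lra. Qed.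

Lemma vertical_primitive_diff x y z :
  Rabs (x - x0) < d -> Rabs (y - y0) < d -> Rabs (z - y0) < d ->
  vertical_primitive x y - vertical_primitive x z = RInt (fun t => f x t) z y.
Proof.
  intros Hx Hy Hz. unfold vertical_primitive.
  pose proof (base_close x Hx) as H0.
  rewrite <- (RInt_Chasles (V := R_CompleteNormedModule) _ y0 z y) by now apply vertical_integrable.
  change plus with Rplus. ring.
Qed.

Lemma vertical_primitive_lipschitz x y z M :
  Rabs (x - x0) < d -> Rabs (y - y0) < d -> Rabs (z - y0) < d ->
  (forall t, Rmin z y <= t <= Rmax z y -> Rabs (f x t) <= M) ->
  Rabs (vertical_primitive x y - vertical_primitive x z) <= M * Rabs (y - z).
Proof.
  intros Hx Hy Hz HM. rewrite vertical_primitive_diff by trivial.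
  rewrite Rmult_comm. apply abs_RInt_le_unordered; trivial. now apply vertical_integrable.
Qed.

Lemma vertical_primitive_is_derive_y x y :
  Rabs (x - x0) < d -> Rabs (y - y0) < d -> is_derive (fun s => vertical_primitive x s) y (f x y).
Proof.
  intros Hx Hy.
  apply (is_derive_RInt (V := R_NormedModule) (fun t => f x t) (fun s => vertical_primitive x s) y0 y).
  - assert (He : 0 < d - Rabs (y - y0)) by lra.
    exists (mkposreal _ He). intros s Hs. change (Rabs (s - y) < d - Rabs (y - y0)) in Hs.
    apply (RInt_correct (V := R_CompleteNormedModule)).
    apply vertical_integrable; [trivial | now apply base_close with x |].
    unfold Rabs in *; repeat destruct Rcase_abs; lra.
  - now apply continuity_2d_pt_section, hf.
Qed.

(** Moving the upper limit costs at most [M] times its displacement, [M] being a local bound on [f].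
    Moving x with the limits fixed is controlled by uniform continuity of [f] near the compact
    segment over [y0, y]. Each part receives half of [eps]. *)
Lemma vertical_primitive_continuous x y :
  Rabs (x - x0) < d -> Rabs (y - y0) < d -> continuity_2d_pt vertical_primitive x y.
Proof.
  intros Hx Hy eps.
  pose proof (cond_pos eps) as Heps. pose proof (base_close x Hx) as H0.
  set (k := 2 * (Rabs (y - y0) + 1)).
  assert (Hk : 0 < k) by (pose proof (Rabs_pos (y - y0)); unfold k; lra).
  assert (He : 0 < eps / k) by now apply Rdiv_lt_0_compat.
  destruct (uniform_continuity_2d_1d' f (Rmin y0 y) (Rmax y0 y) x) with (eps := mkposreal _ He)
    as [d1 H1].
  { intros t Ht. apply hf; trivial. now apply between_close with y0 y. }
  simpl in H1.
  destruct (continuity_2d_pt_near f x y 1 (hf x y Hx Hy)) as [d2 H2]; [lra|].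
  set (M := Rabs (f x y) + 1).
  assert (HM : 0 < M) by (pose proof (Rabs_pos (f x y)); unfold M; lra).
  assert (Hbox : locally_2d (fun u v => Rabs (u - x0) < d /\ Rabs (v - y0) < d) x y).
  { apply locally_2d_open_square with x0 y0 d; trivial. now split. }
  destruct Hbox as [d3 H3].
  assert (He' : 0 < eps / (2 * M)) by (apply Rdiv_lt_0_compat; lra).
  set (m := Rmin (Rmin d1 d2) (Rmin d3 (eps / (2 * M)))).
  assert (Hm : 0 < m) by (repeat apply Rmin_pos; trivial; apply cond_pos).
  exists (mkposreal m Hm). simpl. intros u v Hu Hv.
  apply Rmin_Rgt in Hu as [Hu Hu']. apply Rmin_Rgt in Hu as [Hu1 Hu2].
  apply Rmin_Rgt in Hu' as [Hu3 _].
  apply Rmin_Rgt in Hv as [Hv Hv']. apply Rmin_Rgt in Hv as [Hv1 Hv2].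
  apply Rmin_Rgt in Hv' as [Hv3 Hv4].
  destruct (H3 u v Hu3 Hv3) as [Hub Hvb].
  replace (vertical_primitive u v - vertical_primitive x y) with
    ((vertical_primitive u v - vertical_primitive u y) +
     (vertical_primitive u y - vertical_primitive x y)) by ring.
  assert (HA : Rabs (vertical_primitive u v - vertical_primitive u y) <= M * Rabs (v - y)).
  { apply vertical_primitive_lipschitz; trivial. intros t Ht.
    assert (Htd : Rabs (t - y) < d2).
    { apply between_close with y v; trivial. rewrite Rminus_diag, Rabs_R0. apply cond_pos. }
    apply Rabs_le_near. left. now apply H2. }
  assert (HB : Rabs (vertical_primitive u y - vertical_primitive x y) <=
    Rabs (y - y0) * (eps / k)).
  { unfold vertical_primitive.
    change (RInt (fun t => f u t) y0 y - RInt (fun t => f x t) y0 y)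
      with (minus (RInt (fun t => f u t) y0 y) (RInt (fun t => f x t) y0 y)).
    rewrite <- (RInt_minus (V := R_CompleteNormedModule)) by now apply vertical_integrable.
    apply abs_RInt_le_unordered.
    - apply (ex_RInt_minus (V := R_NormedModule)); now apply vertical_integrable.
    - intros t Ht. left. pose proof (cond_pos d1).
      apply H1; trivial; try lra; [|rewrite Rminus_diag, Rabs_R0; lra].
      unfold Rabs in Hu1; destruct Rcase_abs; lra. }
  assert (HC : M * Rabs (v - y) < eps / 2).
  { apply (Rmult_lt_compat_l M) in Hv4; trivial.
    replace (M * (eps / (2 * M))) with (eps / 2) in Hv4 by (field; lra). exact Hv4. }
  assert (HD : Rabs (y - y0) * (eps / k) <= eps / 2).
  { apply Rle_trans with (k / 2 * (eps / k)).
    - apply Rmult_le_compat_r; [lra | unfold k; lra].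
    - right. field. lra. }
  apply Rle_lt_trans with (1 := Rabs_triang _ _). lra.
Qed.

End VerticalPrimitive.

Lemma vertical_primitive_is_derive_x (f : R -> R -> R) (x0 y0 d x y : R) :
  (forall x y, Rabs (x - x0) < d -> Rabs (y - y0) < d -> C1_at f x y) ->
  Rabs (x - x0) < d -> Rabs (y - y0) < d ->
  is_derive (fun s => vertical_primitive f y0 s y) x
    (vertical_primitive (partial_x f) y0 x y).
Proof.
  intros Hf Hx Hy.
  assert (Hin : forall t, Rmin y0 y <= t <= Rmax y0 y -> Rabs (t - y0) < d).
  { intros t. apply between_close; [|trivial]. now apply (base_close x0 y0 d x). }
  assert (He : 0 < d - Rabs (x - x0)) by lra.
  assert (Hloc : forall s, Rabs (s - x) < mkposreal _ He -> Rabs (s - x0) < d).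
  { simpl. intros s Hs. unfold Rabs in *; repeat destruct Rcase_abs; lra. }
  apply (is_derive_RInt_param f y0 y x).
  - exists (mkposreal _ He). intros s Hs t Ht. exact (proj1 (Hf s t (Hloc s Hs) (Hin t Ht))).
  - intros t Ht. exact (proj1 (proj2 (proj2 (Hf x t Hx (Hin t Ht))))).
  - exists (mkposreal _ He). intros s Hs.
    apply (ex_RInt_continuous (V := R_CompleteNormedModule)). intros t Ht.
    apply (ex_derive_continuous (fun t => f s t)).
    exact (proj1 (proj2 (Hf s t (Hloc s Hs) (Hin t Ht)))).
Qed.

Lemma C1_perturbed_gradient_uniquely_solvable (u F1 F2 V1 V2 : R -> R -> R) (x0 y0 : R) :
  locally_2d (C1_at u) x0 y0 -> locally_2d (C1_at F1) x0 y0 -> locally_2d (C1_at F2) x0 y0 ->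
  locally_2d (continuity_2d_pt V1) x0 y0 ->
  locally_2d (fun x y => (partial_x u x y + F1 x y) * V1 x y +
    (partial_y u x y + F2 x y) * V2 x y = 0) x0 y0 ->
  partial_y u x0 y0 + F2 x0 y0 <> 0 -> V1 x0 y0 <> 0 ->
  locally_uniquely_solvable V1 V2 x0 y0.
Proof.
  intros Hu HF1 HF2 HV1 HGV HG2 HV.
  destruct (locally_2d_singleton _ _ _ HF1) as (_ & _ & _ & HcF1).
  destruct (locally_2d_singleton _ _ _ HF2) as (_ & _ & HcF2 & _).
  destruct (continuity_2d_pt_near _ _ _ 1 HcF1) as [e1 He1]; [lra|].
  destruct (continuity_2d_pt_near _ _ _ 1 HcF2) as [e2 He2]; [lra|].
  pose proof (C1_differentiable _ _ _ HF2) as HdF2.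
  destruct Hu as [d1 Hu], HF1 as [d2 HF1], HF2 as [d3 HF2], HV1 as [d4 HV1], HGV as [d5 HGV].
  set (m := Rmin (Rmin e1 e2) (Rmin (Rmin d1 d2) (Rmin d3 (Rmin d4 d5)))).
  assert (Hm : 0 < m) by (repeat apply Rmin_pos; apply cond_pos).
  assert (Hmd : forall z, Rabs z < m -> (Rabs z < e1 /\ Rabs z < e2) /\
    Rabs z < d1 /\ Rabs z < d2 /\ Rabs z < d3 /\ Rabs z < d4 /\ Rabs z < d5).
  { intros z Hz. clear -Hz.
    apply Rmin_Rgt in Hz as [H0 Hz]. apply Rmin_Rgt in H0 as [H0 H0'].
    apply Rmin_Rgt in Hz as [H1 H2]. apply Rmin_Rgt in H1 as [H1 H1'].
    apply Rmin_Rgt in H2 as [H2 H2']. apply Rmin_Rgt in H2' as [H2' H2''].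
    repeat split; assumption. }
  assert (HuB : forall x y, Rabs (x - x0) < m -> Rabs (y - y0) < m -> C1_at u x y).
  { intros x y Hx Hy. apply Hmd in Hx, Hy. now apply Hu. }
  assert (HF1B : forall x y, Rabs (x - x0) < m -> Rabs (y - y0) < m -> C1_at F1 x y).
  { intros x y Hx Hy. apply Hmd in Hx, Hy. now apply HF1. }
  assert (HF2B : forall x y, Rabs (x - x0) < m -> Rabs (y - y0) < m -> C1_at F2 x y).
  { intros x y Hx Hy. apply Hmd in Hx, Hy. now apply HF2. }
  assert (HF2c : forall x y, Rabs (x - x0) < m -> Rabs (y - y0) < m -> continuity_2d_pt F2 x y).
  { intros x y Hx Hy. eapply differentiable_pt_lim_continuity, C1_differentiable.
    now apply locally_2d_open_square with x0 y0 m. }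
  assert (HF2x : forall x y, Rabs (x - x0) < m -> Rabs (y - y0) < m ->
    continuity_2d_pt (partial_x F2) x y) by (intros x y Hx Hy; now apply HF2B).
  (* Here Tx - Q = u_x + F1, so the relation between the potential and the field is exactly the
     orthogonality [HGV]. In the Lipschitz constant each 1 is the tolerance used for [e1] and
     [e2]. *)
  apply (transversal_potential_uniquely_solvable
    (fun x y => u x y + vertical_primitive F2 y0 x y)
    (fun x y => partial_x u x y + vertical_primitive (partial_x F2) y0 x y)
    (fun x y => partial_y u x y + F2 x y)
    (fun x y => - F1 x y + vertical_primitive (partial_x F2) y0 x y)
    V1 V2 x0 y0 ((Rabs (partial_y F1 x0 y0) + 1) + (Rabs (partial_x F2 x0 y0) + 1))
    (mkposreal m Hm)); trivial; simpl.
  - exists (mkposreal m Hm). simpl. intros x y Hx Hy.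
    destruct (HuB x y Hx Hy) as (_ & Huy & Hucx & _).
    repeat split.
    + apply (differentiable_pt_lim_partials (fun x y => u x y + vertical_primitive F2 y0 x y)
        (fun x y => partial_x u x y + vertical_primitive (partial_x F2) y0 x y)).
      * apply locally_2d_open_square with x0 y0 m; trivial. intros a b Ha Hb.
        apply (is_derive_plus (fun s => u s b) (fun s => vertical_primitive F2 y0 s b)).
        -- exact (Derive_correct _ _ (proj1 (HuB a b Ha Hb))).
        -- now apply vertical_primitive_is_derive_x with x0 m.
      * apply (is_derive_plus (fun s => u x s) (fun s => vertical_primitive F2 y0 x s)).
        -- now apply Derive_correct.
        -- now apply vertical_primitive_is_derive_y with x0 m.
      * apply continuity_2d_pt_plus; trivial.
        now apply vertical_primitive_continuous with x0 m.
    + apply continuity_2d_pt_plus; [apply continuity_2d_pt_opp|].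
      * eapply differentiable_pt_lim_continuity, C1_differentiable.
        now apply locally_2d_open_square with x0 y0 m.
      * now apply vertical_primitive_continuous with x0 m.
    + apply Hmd in Hx, Hy. now apply HV1.
    + apply Hmd in Hx, Hy.
      assert (E : (partial_x u x y + F1 x y) * V1 x y + (partial_y u x y + F2 x y) * V2 x y = 0)
        by now apply HGV.
      lra.
  - apply continuity_2d_pt_plus.
    + apply HuB; rewrite Rminus_diag, Rabs_R0; exact Hm.
    + now apply differentiable_pt_lim_continuity in HdF2.
  - intros x y z Hx Hy Hz.
    (* The Lipschitz bound on [Q] in y comes from the mean value theorem for [F1], and from the
       boundedness of the integrand d_x F2 for the primitive. *)
    destruct (mean_value (fun s => F1 x s) (partial_y F1 x) z y) as [c [Hc E]].
    { intros t Ht. apply Derive_correct. apply HF1B; trivial. now apply between_close with z y. }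
    assert (Hcb : Rabs (c - y0) < m) by now apply between_close with z y.
    assert (HA : Rabs (F1 x y - F1 x z) <= (Rabs (partial_y F1 x0 y0) + 1) * Rabs (y - z)).
    { rewrite E, Rabs_mult. apply Rmult_le_compat_r; [apply Rabs_pos|].
      apply Rabs_le_near. left.
      exact (He1 x c (proj1 (proj1 (Hmd _ Hx))) (proj1 (proj1 (Hmd _ Hcb)))). }
    assert (HB : Rabs (vertical_primitive (partial_x F2) y0 x y -
      vertical_primitive (partial_x F2) y0 x z) <= (Rabs (partial_x F2 x0 y0) + 1) * Rabs (y - z)).
    { apply vertical_primitive_lipschitz with x0 m; trivial. intros t Ht.
      assert (Htb : Rabs (t - y0) < m) by now apply between_close with z y.
      apply Rabs_le_near. left.
      exact (He2 x t (proj2 (proj1 (Hmd _ Hx))) (proj2 (proj1 (Hmd _ Htb)))). }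
    rewrite Rmult_plus_distr_r.
    match goal with |- Rabs (- ?a + ?b - (- ?c' + ?e)) <= _ =>
      replace (- a + b - (- c' + e)) with (- (a - c') + (b - e)) by ring end.
    apply Rle_trans with (1 := Rabs_triang _ _). rewrite Rabs_Ropp. lra.
Qed.

(** * Characteristic curves *)

Lemma continuity_2d_pt_swap (f : R -> R -> R) (x y : R) :
  continuity_2d_pt f x y -> continuity_2d_pt (fun a b => f b a) y x.
Proof. intros H eps. exact (locally_2d_swap _ _ _ (H eps)). Qed.

Lemma C1_at_swap (f : R -> R -> R) (x y : R) :
  locally_2d (C1_at f) x y -> locally_2d (C1_at (fun a b => f b a)) y x.
Proof.
  intros H. apply locally_2d_swap in H. revert H.
  apply locally_2d_impl, locally_2d_forall. intros a b (H1 & H2 & H3 & H4).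
  split; [exact H2|]. split; [exact H1|].
  split; [exact (continuity_2d_pt_swap _ _ _ H4) | exact (continuity_2d_pt_swap _ _ _ H3)].
Qed.

Lemma open_locally_2d (D : R * R -> Prop) (P : R -> R -> Prop) (x y : R) :
  open D -> D (x, y) -> (forall a b, D (a, b) -> P a b) -> locally_2d P x y.
Proof.
  intros Ho Hp HP. apply locally_2d_locally.
  apply filter_imp with (2 := Ho _ Hp). intros [a b]. apply HP.
Qed.

Lemma C1_on_C1_at (D : R * R -> Prop) (f : R * R -> R) (x y : R) :
  C1_on D f -> D (x, y) -> C1_at (fun a b => f (a, b)) x y.
Proof.
  intros Hf Hp. destruct (Hf _ Hp) as (H1 & H2 & H3 & H4).
  split; [exact H1|]. split; [exact H2|].
  split; [apply (continuity_2d_pt_filterlim (partial_x (fun a b => f (a, b)))); exact H3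
         | apply (continuity_2d_pt_filterlim (partial_y (fun a b => f (a, b)))); exact H4].
Qed.

Lemma C1_at_continuous (f : R -> R -> R) (x y : R) :
  locally_2d (C1_at f) x y -> continuity_2d_pt f x y.
Proof.
  intros H. eapply differentiable_pt_lim_continuity. now apply C1_differentiable.
Qed.

Lemma norm_R2 (a b : R) : norm (a, b) = sqrt (a * a + b * b).
Proof.
  change (sqrt (Rabs a ^ 2 + Rabs b ^ 2) = sqrt (a * a + b * b)).
  rewrite !pow2_abs. f_equal. ring.
Qed.

Lemma continuity_2d_pt_normalise (f g h : R -> R -> R) (x y : R) :
  continuity_2d_pt f x y -> continuity_2d_pt g x y -> continuity_2d_pt h x y ->
  norm (f x y, g x y) <> 0 -> continuity_2d_pt (fun a b => / norm (f a b, g a b) * h a b) x y.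
Proof.
  intros Hf Hg Hh Hn. apply continuity_2d_pt_mult; trivial.
  apply (continuity_2d_pt_inv (fun a b => norm (f a b, g a b))); trivial.
  apply continuity_2d_pt_ext with (fun a b => sqrt (f a b * f a b + g a b * g a b)).
  - intros a b. symmetry. apply norm_R2.
  - apply continuity_1d_2d_pt_comp.
    + apply continuity_pt_sqrt. apply Rplus_le_le_0_compat; apply Rle_0_sqr.
    + apply continuity_2d_pt_plus; now apply continuity_2d_pt_mult.
Qed.

Lemma Nperp_locally_uniquely_solvable (Omega : R * R -> Prop) (F : R * R -> R * R)
    (u : R * R -> R) (x0 y0 : R) :
  open Omega -> C1_field_on Omega F -> C1_on Omega u -> nonsingular Omega F u ->
  Omega (x0, y0) ->
  locally_uniquely_solvable (fun x y => fst (Nperp F u (x, y)))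
    (fun x y => snd (Nperp F u (x, y))) x0 y0.
Proof.
  intros Ho [HF1 HF2] Hu Hns Hp.
  assert (Hloc : forall f x y, C1_on Omega f -> Omega (x, y) ->
    locally_2d (C1_at (fun a b => f (a, b))) x y).
  { intros f x y Hf Hxy. apply (open_locally_2d Omega); trivial.
    intros a b Hab. now apply C1_on_C1_at with Omega. }
  set (u' := fun a b => u (a, b)).
  set (F1 := fun a b => fst (F (a, b))). set (F2 := fun a b => snd (F (a, b))).
  set (G1 := fun a b => partial_x u' a b + F1 a b).
  set (G2 := fun a b => partial_y u' a b + F2 a b).
  assert (HG : forall a b, Omega (a, b) -> continuity_2d_pt G1 a b /\ continuity_2d_pt G2 a b).
  { intros a b Hab. destruct (C1_on_C1_at _ _ _ _ Hu Hab) as (_ & _ & H1 & H2).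
    split; apply continuity_2d_pt_plus; trivial; apply C1_at_continuous.
    - now apply (Hloc (fun z => fst (F z))).
    - now apply (Hloc (fun z => snd (F z))). }
  assert (Hn : forall a b, Omega (a, b) -> norm (G1 a b, G2 a b) <> 0).
  { intros a b Hab E. apply (Hns _ Hab).
    exact (norm_eq_zero (K := R_AbsRing) (V := prod_NormedModule R_AbsRing R_NormedModule R_NormedModule) _ E). }
  set (V1 := fun a b => / norm (G1 a b, G2 a b) * G2 a b).
  set (V2 := fun a b => - (/ norm (G1 a b, G2 a b) * G1 a b)).
  (* With G = grad u + F, the rotated unit field is (G2, - G1) / |G|, componentwise convertible to
     [V1], [V2]. *)
  change (locally_uniquely_solvable V1 V2 x0 y0).
  assert (HVc : forall a b, Omega (a, b) -> continuity_2d_pt V1 a b /\ continuity_2d_pt V2 a b).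
  { intros a b Hab. destruct (HG a b Hab). split.
    - now apply continuity_2d_pt_normalise; [.. | apply Hn].
    - apply continuity_2d_pt_opp. now apply continuity_2d_pt_normalise; [.. | apply Hn]. }
  assert (Hne : forall g, g <> 0 -> / norm (G1 x0 y0, G2 x0 y0) * g <> 0).
  { intros g Hg. apply Rmult_integral_contrapositive_currified; trivial.
    now apply Rinv_neq_0_compat, Hn. }
  (* If G2 vanishes at p then G1 does not, and exchanging the coordinates turns (F1, F2) into (F2,
     F1) and makes G1 the vertical component. *)
  destruct (Req_dec (G2 x0 y0) 0) as [E2|E2].
  - assert (E1 : G1 x0 y0 <> 0).
    { intros E1. apply (Hn _ _ Hp). rewrite E1, E2.
      exact (norm_zero (K := R_AbsRing) (V := prod_NormedModule R_AbsRing R_NormedModule R_NormedModule)). }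
    apply locally_uniquely_solvable_swap.
    apply (C1_perturbed_gradient_uniquely_solvable (fun a b => u' b a) (fun a b => F2 b a)
      (fun a b => F1 b a)).
    + now apply C1_at_swap, Hloc.
    + now apply (C1_at_swap F2), (Hloc (fun z => snd (F z))).
    + now apply (C1_at_swap F1), (Hloc (fun z => fst (F z))).
    + apply (locally_2d_swap (fun a b => continuity_2d_pt (fun x y => V2 y x) b a)).
      apply (open_locally_2d Omega); trivial. intros a b Hab.
      now apply continuity_2d_pt_swap, HVc.
    + apply locally_2d_forall. intros a b. unfold V1, V2.
      change (G2 b a * - (/ norm (G1 b a, G2 b a) * G1 b a) +
        G1 b a * (/ norm (G1 b a, G2 b a) * G2 b a) = 0). ring.
    + exact E1.
    + unfold V2. apply Ropp_neq_0_compat. now apply Hne.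
  - apply (C1_perturbed_gradient_uniquely_solvable u' F1 F2).
    + now apply Hloc.
    + now apply (Hloc (fun z => fst (F z))).
    + now apply (Hloc (fun z => snd (F z))).
    + apply (open_locally_2d Omega); trivial. intros a b Hab. now apply HVc.
    + apply locally_2d_forall. intros a b. unfold V1, V2.
      change (G1 a b * (/ norm (G1 a b, G2 a b) * G2 a b) +
        G2 a b * - (/ norm (G1 a b, G2 a b) * G1 a b) = 0). ring.
    + exact E2.
    + now apply Hne.
Qed.

Lemma is_derive_pair (g : R -> R * R) (t : R) (l : R * R) :
  is_derive g t l <->
  is_derive (fun s => fst (g s)) t (fst l) /\ is_derive (fun s => snd (g s)) t (snd l).
Proof.
  split.
  - intros H. split.
    + apply (filterdiff_comp' (K := R_AbsRing) (W := R_NormedModule) g fst t _ fst H).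
      apply filterdiff_linear, (is_linear_fst (K := R_AbsRing) (U := R_NormedModule) (V := R_NormedModule)).
    + apply (filterdiff_comp' (K := R_AbsRing) (W := R_NormedModule) g snd t _ snd H).
      apply filterdiff_linear, (is_linear_snd (K := R_AbsRing) (U := R_NormedModule) (V := R_NormedModule)).
  - intros [H1 H2]. unfold is_derive.
    apply filterdiff_ext with (fun s => (fst (g s), snd (g s))).
    { intros s. now destruct (g s). }
    apply (filterdiff_comp'_2 (K := R_AbsRing)
      (W := prod_NormedModule R_AbsRing R_NormedModule R_NormedModule)
      (fun s => fst (g s)) (fun s => snd (g s)) pair t _ _ pair H1 H2).
    apply filterdiff_ext with (fun z => z); [now intros [a b]|].
    apply filterdiff_ext_lin with (fun z => z); [apply filterdiff_id | now intros [a b]].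
Qed.

Lemma Rabs_fst_le_norm (z : R * R) : Rabs (fst z) <= norm z.
Proof.
  apply Rle_trans with (2 := proj1 (norm_prod (K := R_AbsRing) (U := R_NormedModule)
    (V := R_NormedModule) (fst z) (snd z))). apply Rmax_l.
Qed.

Lemma Rabs_snd_le_norm (z : R * R) : Rabs (snd z) <= norm z.
Proof.
  apply Rle_trans with (2 := proj1 (norm_prod (K := R_AbsRing) (U := R_NormedModule)
    (V := R_NormedModule) (fst z) (snd z))). apply Rmax_r.
Qed.

Lemma open_disc_locally_2d (p : R * R) (r x y : R) :
  open_disc p r (x, y) -> locally_2d (fun a b => open_disc p r (a, b)) x y.
Proof.
  unfold open_disc. intros H.
  set (e := r - norm (minus (x, y) p)).
  (* Half of the remaining room suffices, since the Euclidean norm is at most sqrt 2 <= 2 times the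
     maximum norm in which [locally_2d] is stated. *)
  assert (He : 0 < e / 2) by (unfold e; lra).
  exists (mkposreal _ He). simpl. intros a b Ha Hb.
  replace (minus (a, b) p) with (plus (minus (a, b) (x, y)) (minus (x, y) p)).
  - apply Rle_lt_trans with (1 := norm_triangle (K := R_AbsRing)
      (V := prod_NormedModule R_AbsRing R_NormedModule R_NormedModule) _ _).
    assert (norm (minus (a, b) (x, y)) < e); [|unfold e in *; lra].
    apply Rle_lt_trans with (1 := proj2 (norm_prod (K := R_AbsRing) (U := R_NormedModule)
      (V := R_NormedModule) (a - x) (b - y))).
    assert (Hm : Rmax (Rabs (a - x)) (Rabs (b - y)) < e / 2) by now apply Rmax_lub_lt.
    apply Rle_lt_trans with (2 * Rmax (Rabs (a - x)) (Rabs (b - y))); [|lra].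
    apply Rmult_le_compat_r.
    + apply Rle_trans with (1 := Rabs_pos (a - x)). apply Rmax_l.
    + pose proof (sqrt_le_1_alt 2 (2 * 2)) as H2. rewrite sqrt_square in H2 by lra. lra.
  - symmetry. apply (minus_trans (x, y)).
Qed.

Lemma integral_curve_solves (V : R * R -> R * R) (D : R * R -> Prop) (J : R -> Prop)
    (g : R -> R * R) :
  integral_curve V D J g <->
  open J /\ solves (fun x y => fst (V (x, y))) (fun x y => snd (V (x, y)))
    (fun x y => D (x, y)) J (fun t => fst (g t)) (fun t => snd (g t)).
Proof.
  unfold integral_curve, solves. split.
  - intros (Ho & Hc & H). split; [exact Ho|]. split; [exact Hc|]. intros t Ht.
    rewrite <- (surjective_pairing (g t)). destruct (H t Ht) as [HD Hg]. split; [exact HD|].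
    now apply is_derive_pair.
  - intros (Ho & Hc & H). split; [exact Ho|]. split; [exact Hc|]. intros t Ht.
    specialize (H t Ht). rewrite <- (surjective_pairing (g t)) in H.
    destruct H as [HD Hg]. split; [exact HD|]. now apply is_derive_pair.
Qed.

Theorem mainTheorem3 (Omega : R * R -> Prop) (F : R * R -> R * R)
    (u : R * R -> R)
    (hOmega : planar_domain Omega)
    (hF : C1_field_on Omega F)
    (hu : C1_on Omega u)
    (hns : nonsingular Omega F u) :
  forall p : R * R, Omega p ->
  exists r1 : R, 0 < r1 /\
    (forall q, open_disc p r1 q -> Omega q) /\
    exists (I : R -> Prop) (gamma : R -> R * R),
      unique_characteristic_curve_through F u (open_disc p r1) p I gamma.
Proof.
  intros [x0 y0] Hp. destruct hOmega as [Ho _].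
  destruct (Nperp_locally_uniquely_solvable Omega F u x0 y0) as (r & Hr & Hsolve); trivial.
  destruct (open_locally_2d Omega (fun a b => Omega (a, b)) x0 y0) as [d Hd]; trivial.
  (* The disc lies in the square of the same radius: [d] keeps that square in [Omega], and [r] makes
     the disc an admissible set [D] for local solvability. *)
  set (r1 := Rmin r d).
  assert (Hr1 : 0 < r1) by (apply Rmin_pos; [exact Hr | apply cond_pos]).
  assert (Hclose : forall x y, open_disc (x0, y0) r1 (x, y) ->
    Rabs (x - x0) < r1 /\ Rabs (y - y0) < r1).
  { intros x y H. split.
    - exact (Rle_lt_trans _ _ _ (Rabs_fst_le_norm (minus (x, y) (x0, y0))) H).
    - exact (Rle_lt_trans _ _ _ (Rabs_snd_le_norm (minus (x, y) (x0, y0))) H). }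
  exists r1. split; [exact Hr1|]. split.
  { intros [x y] H. destruct (Hclose x y H) as [Hx Hy].
    apply Hd; eapply Rlt_le_trans; try eassumption; apply Rmin_r. }
  destruct (Hsolve (fun x y => open_disc (x0, y0) r1 (x, y)))
    as (I & X & Y & HIo & HS & HI0 & HX & HY & HU).
  - intros x y. apply open_disc_locally_2d.
  - unfold open_disc. rewrite minus_eq_zero.
    apply Rle_lt_trans with (2 := Hr1). right.
    exact (norm_zero (K := R_AbsRing) (V := prod_NormedModule R_AbsRing R_NormedModule R_NormedModule)).
  - intros x y H. destruct (Hclose x y H) as [Hx Hy].
    split; eapply Rlt_le_trans; try eassumption; apply Rmin_l.
  - exists I, (fun t => (X t, Y t)). split; [|split; [exact HI0|split]].
    + apply integral_curve_solves. now split.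
    + now rewrite HX, HY.
    + intros J eta s HJ Hs Heta t Ht.
      apply integral_curve_solves in HJ as [_ HJ].
      destruct (HU J (fun t => fst (eta t)) (fun t => snd (eta t)) s HJ Hs) with (t := t)
        as (HI & Hx & Hy); trivial; [now rewrite Heta | now rewrite Heta |].
      split; [exact HI|]. now rewrite <- Hx, <- Hy, <- surjective_pairing.
Qed.
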